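(* (i) Let $0\le B<A\le 1$. Then $R_{\mathcal{S}^*_{Ne}}(\mathcal{S}^*[A,B])=\min\{1,\,2/(3A-B)\}$. In particular, if $1-B\le 3(1-A)$, then $\mathcal{S}^*[A,B]\subset\mathcal{S}^*_{Ne}$. (ii) Let $-1\le B<A\le 1$ with $B\le 0$. Then $R_{\mathcal{S}^*_{Ne}}(\mathcal{S}^*[A,B])=\min\{1,\,2/(3A-5B)\}$. In particular, if $3(1+A)\le 5(1+B)$, then $\mathcal{S}^*[A,B]\subset\mathcal{S}^*_{Ne}$.
   Context: $\mathbb{D}=\{|z|<1\}$, $\mathbb{D}_r=\{|z|<r\}$. $\mathcal{A}$ is the class of analytic $f$ on $\mathbb{D}$ with $f(0)=0$, $f'(0)=1$; for $f\in\mathcal{A}$ let $\mathcal{Q}_f(z)=zf'(z)/f(z)$. For analytic $F,G$ on $\mathbb{D}$, $F\prec G$ means $F=G\circ w$ for some analytic $w:\mathbb{D}\to\mathbb{D}$ with $w(0)=0$. For analytic $\varphi$ on $\mathbb{D}$, $\mathcal{S}^*(\varphi)=\{f\in\mathcal{A}:\mathcal{Q}_f\prec\varphi\}$. Let $\varphi_{Ne}(z)=1+z-z^3/3$ (univalent on $\mathbb{D}$), $\Omega_{Ne}=\varphi_{Ne}(\mathbb{D})$, and $\mathcal{S}^*_{Ne}=\mathcal{S}^*(\varphi_{Ne})$. For $\mathcal{G}\subset\mathcal{A}$, the $\mathcal{S}^*_{Ne}$-radius $R_{\mathcal{S}^*_{Ne}}(\mathcal{G})$ is the largest $\rho\in(0,1]$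 such that for every $f\in\mathcal{G}$ and every $0<r\le\rho$ the function $r^{-1}f(rz)$ belongs to $\mathcal{S}^*_{Ne}$; equivalently, the largest $\rho\in(0,1]$ with $\mathcal{Q}_f(\mathbb{D}_\rho)\subseteq\Omega_{Ne}$ for all $f\in\mathcal{G}$. For $-1\le B<A\le1$, the Janowski class is $\mathcal{S}^*[A,B]=\mathcal{S}^*\big(\frac{1+Az}{1+Bz}\big)$. *)

(* Defs.v *)
From Stdlib Require Import Reals.
Open Scope R_scope.

Definition Cx : Type := (R * R)%type.
Definition Cre (z : Cx) : R := fst z.
Definition Cim (z : Cx) : R := snd z.
Definition RtoC (x : R) : Cx := (x, 0).
Definition C0 : Cx := (0, 0).
Definition C1 : Cx := (1, 0).
Definition Cadd (z w : Cx) : Cx := (fst z + fst w, snd z + snd w).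
Definition Copp (z : Cx) : Cx := (- fst z, - snd z).
Definition Csub (z w : Cx) : Cx := Cadd z (Copp w).
Definition Cmul (z w : Cx) : Cx :=
  (fst z * fst w - snd z * snd w, fst z * snd w + snd z * fst w).
Definition Cinv (z : Cx) : Cx :=
  (fst z / (fst z ^ 2 + snd z ^ 2), - snd z / (fst z ^ 2 + snd z ^ 2)).
Definition Cdiv (z w : Cx) : Cx := Cmul z (Cinv w).
Definition Cnorm (z : Cx) : R := sqrt (fst z ^ 2 + snd z ^ 2).

Definition has_cderiv (f : Cx -> Cx) (z l : Cx) : Prop :=
  forall eps : R, 0 < eps -> exists delta : R, 0 < delta /\
    forall h : Cx, h <> C0 -> Cnorm h < delta ->
      Cnorm (Csub (Cdiv (Csub (f (Cadd z h)) (f z)) h) l) < eps.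

Definition analytic_on_D (f : Cx -> Cx) : Prop :=
  forall z : Cx, Cnorm z < 1 -> exists l : Cx, has_cderiv f z l.

Definition classA (f : Cx -> Cx) : Prop :=
  analytic_on_D f /\ f C0 = C0 /\ has_cderiv f C0 C1.

Definition schwarz (w : Cx -> Cx) : Prop :=
  analytic_on_D w /\ w C0 = C0 /\ (forall z : Cx, Cnorm z < 1 -> Cnorm (w z) < 1).

(* Q_f(z) = z f'(z)/f(z) is subordinate to phi:  Q_f = phi o w on D.
   For z <> 0 this says f(z) <> 0 and z f'(z)/f(z) = phi(w z); at z = 0,
   Q_f(0) = 1 = phi(0) by the removable singularity (f(0)=0, f'(0)=1). *)
Definition Qf_subord (f phi : Cx -> Cx) : Prop :=
  exists w : Cx -> Cx, schwarz w /\
    forall z : Cx, Cnorm z < 1 -> z <> C0 ->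
      f z <> C0 /\
      exists l : Cx, has_cderiv f z l /\ Cdiv (Cmul z l) (f z) = phi (w z).

Definition Sstar (phi : Cx -> Cx) (f : Cx -> Cx) : Prop :=
  classA f /\ Qf_subord f phi.

Definition phiNe (z : Cx) : Cx :=
  Csub (Cadd C1 z) (Cdiv (Cmul z (Cmul z z)) (RtoC 3)).

Definition SstarNe (f : Cx -> Cx) : Prop := Sstar phiNe f.

Definition janowski (A B : R) (z : Cx) : Cx :=
  Cdiv (Cadd C1 (Cmul (RtoC A) z)) (Cadd C1 (Cmul (RtoC B) z)).

Definition SstarJ (A B : R) (f : Cx -> Cx) : Prop := Sstar (janowski A B) f.

Definition Ne_radius_ok (G : (Cx -> Cx) -> Prop) (rho : R) : Prop :=
  0 < rho /\ rho <= 1 /\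
  forall f : Cx -> Cx, G f -> forall r : R, 0 < r -> r <= rho ->
    SstarNe (fun z => Cdiv (f (Cmul (RtoC r) z)) (RtoC r)).

Definition is_Ne_radius (G : (Cx -> Cx) -> Prop) (rho : R) : Prop :=
  Ne_radius_ok G rho /\ (forall rho' : R, Ne_radius_ok G rho' -> rho' <= rho).

(* Main.v *)
Require Import Defs.
From Stdlib Require Import Reals Lra Lia ClassicalEpsilon FunctionalExtensionality.
From Coquelicot Require Import Coquelicot.
Open Scope R_scope.

(** All discs in question lie in |q - 1| < 2/3, which phi_Ne covers univalently: the equation
    z - z^3/3 = c with |c| < 2/3 is solved by iterating the contraction z |-> c + z^3/3.  By the
    Schwarz lemma z f'(z)/f(z) on |z| < r takes values J(w) with |w| < r, where J is the Janowski
    function, and |J(w) - 1| = (A - B)|w|/|1 + B w| < 2/3 as soon as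
    (3 (A - B) + 2 |B|) r <= 2.  This bound is 2/(3A - B) or 2/(3A - 5B) according to the sign
    of B, and it is sharp because the extremal Janowski function then reaches a cusp 1/3 or 5/3
    of the nephroid.

    As analyticity is pointwise complex differentiability, the Schwarz lemma is derived from
    Goursat's bisection argument, via the mean value property and the maximum principle.  *)

(** * Complex differentiability *)

(** The radius 2/3 is the distance from 1 to the cusps phi_Ne(-1) = 1/3 and phi_Ne(1) = 5/3, so no
    larger disc about 1 fits into the nephroid domain. One formula serves both signs of B because,
    for B different from 0, |J(w) - 1| on |w| = r is largest where B w = -|B| r. This point is real,
    so J(w) lies on the real axis, which carries the cusps: to the left of 1 for B > 0, to the right
    for B < 0. Hence the disc criterion loses nothing.

    Subordination asks for an analytic Schwarz function, not only for an inclusion of values. The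
    preimage under the cubic must therefore be differentiable in c; a lower bound on the difference
    quotients of the cubic yields this directly. *)

Lemma sqrt2_le_2 : sqrt 2 <= 2.
Proof. rewrite <- (sqrt_square 2) at 2 by lra. apply sqrt_le_1; lra. Qed.

Definition ccont (f : C -> C) (z : C) : Prop :=
  forall eps : R, 0 < eps -> exists d : R, 0 < d /\
    forall x : C, Cmod (x - z) < d -> Cmod (f x - f z) < eps.

Lemma ccont_const (c z : C) : ccont (fun _ => c) z.
Proof.
  intros eps He. exists 1. split; [lra|]. intros x _.
  replace (c - c)%C with (RtoC 0) by ring. rewrite Cmod_0. exact He.
Qed.

Lemma ccont_id (z : C) : ccont (fun x => x) z.
Proof. intros eps He. exists eps. split; auto. Qed.

Lemma ccont_plus (f g : C -> C) (z : C) :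
  ccont f z -> ccont g z -> ccont (fun x => f x + g x)%C z.
Proof.
  intros Hf Hg eps He.
  destruct (Hf (eps / 2) ltac:(lra)) as [d1 [Hd1 H1]].
  destruct (Hg (eps / 2) ltac:(lra)) as [d2 [Hd2 H2]].
  exists (Rmin d1 d2). split; [now apply Rmin_pos|]. intros x Hx.
  specialize (H1 x (Rlt_le_trans _ _ _ Hx (Rmin_l _ _))).
  specialize (H2 x (Rlt_le_trans _ _ _ Hx (Rmin_r _ _))).
  replace (f x + g x - (f z + g z))%C with ((f x - f z) + (g x - g z))%C by ring.
  eapply Rle_lt_trans; [apply Cmod_triangle|lra].
Qed.

Lemma ccont_mult (f g : C -> C) (z : C) :
  ccont f z -> ccont g z -> ccont (fun x => f x * g x)%C z.
Proof.
  intros Hf Hg eps He.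
  set (K := Cmod (f z) + Cmod (g z) + 1).
  assert (HK : 1 <= K) by (unfold K; pose proof (Cmod_ge_0 (f z)); pose proof (Cmod_ge_0 (g z)); lra).
  (* The cap 1 makes the product of the two increments at most e; this is the summand 1 in K. *)
  set (e := Rmin 1 (eps / (2 * K))).
  assert (Hq : 0 < eps / (2 * K)) by (apply Rdiv_lt_0_compat; lra).
  assert (He' : 0 < e) by (apply Rmin_pos; lra).
  destruct (Hf e He') as [d1 [Hd1 H1]].
  destruct (Hg e He') as [d2 [Hd2 H2]].
  exists (Rmin d1 d2). split; [now apply Rmin_pos|]. intros x Hx.
  specialize (H1 x (Rlt_le_trans _ _ _ Hx (Rmin_l _ _))).
  specialize (H2 x (Rlt_le_trans _ _ _ Hx (Rmin_r _ _))).
  replace (f x * g x - f z * g z)%C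
    with ((f x - f z) * (g x - g z) + ((f x - f z) * g z + f z * (g x - g z)))%C by ring.
  assert (E1 : e <= 1) by apply Rmin_l.
  assert (E2 : e * K <= eps / 2).
  { apply Rle_trans with (eps / (2 * K) * K).
    - apply Rmult_le_compat_r; [lra|apply Rmin_r].
    - right. field. lra. }
  eapply Rle_lt_trans; [apply Cmod_triangle|].
  eapply Rle_lt_trans; [apply Rplus_le_compat_l, Cmod_triangle|].
  rewrite !Cmod_mult.
  pose proof (Cmod_ge_0 (f x - f z)). pose proof (Cmod_ge_0 (g x - g z)).
  pose proof (Cmod_ge_0 (f z)). pose proof (Cmod_ge_0 (g z)).
  assert (Cmod (f x - f z) * Cmod (g x - g z) <= e * 1) by (apply Rmult_le_compat; lra).
  assert (Cmod (f x - f z) * Cmod (g z) <= e * Cmod (g z)) by (apply Rmult_le_compat_r; lra).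
  assert (Cmod (f z) * Cmod (g x - g z) <= Cmod (f z) * e) by (apply Rmult_le_compat_l; lra).
  unfold K in E2. nra.
Qed.

Lemma ccont_inv (f : C -> C) (z : C) :
  ccont f z -> f z <> 0 -> ccont (fun x => / f x)%C z.
Proof.
  intros Hf Hz eps He.
  assert (Hm : 0 < Cmod (f z)) by now apply Cmod_gt_0.
  set (m := Cmod (f z)) in *.
  (* The first bound keeps |f x| > m / 2, the second then absorbs the denominator |f x| m > m^2 /
     2. *)
  set (e := Rmin (m / 2) (eps * (m * m) / 2)).
  assert (He' : 0 < e) by (apply Rmin_pos; [lra | assert (0 < m * m) by nra; nra]).
  destruct (Hf e He') as [d [Hd H]].
  exists d. split; [exact Hd|]. intros x Hx. specialize (H x Hx).
  assert (E1 : e <= m / 2) by apply Rmin_l.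
  assert (E2 : e <= eps * (m * m) / 2) by apply Rmin_r.
  assert (Hfx : m / 2 < Cmod (f x)).
  { assert (m <= Cmod (f x) + Cmod (f x - f z)).
    { unfold m. rewrite <- (Cmod_opp (f x - f z)).
      replace (f z) with (f x + - (f x - f z))%C at 1 by ring. apply Cmod_triangle. }
    lra. }
  assert (Hx0 : f x <> 0) by (apply Cmod_gt_0; lra).
  replace (/ f x - / f z)%C with (- (f x - f z) / (f x * f z))%C by (field; auto).
  rewrite Cmod_div by now apply Cmult_neq_0.
  rewrite Cmod_opp, Cmod_mult. fold m.
  apply Rmult_lt_reg_r with (Cmod (f x) * m); [nra|].
  unfold Rdiv. rewrite Rmult_assoc, Rinv_l by nra.
  assert (eps * (m * m) / 2 < eps * (Cmod (f x) * m)) by nra. lra.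
Qed.

Lemma ccont_comp (f g : C -> C) (z : C) :
  ccont g z -> ccont f (g z) -> ccont (fun x => f (g x)) z.
Proof.
  intros Hg Hf eps He. destruct (Hf eps He) as [d [Hd H]].
  destruct (Hg d Hd) as [d' [Hd' H']]. exists d'. split; auto.
Qed.

Lemma ccont_pow (f : C -> C) (n : nat) (z : C) :
  ccont f z -> ccont (fun x => f x ^ n)%C z.
Proof.
  intros Hf. induction n as [|n IH]; simpl.
  - apply ccont_const.
  - now apply ccont_mult.
Qed.

(* Caratheodory's form of complex differentiability: the increment factors through a slope
   function continuous at the point. *)
Lemma cderiv_slope (f : C -> C) (z l : C) : has_cderiv f z l ->
  exists q : C -> C, ccont q z /\ q z = l /\ forall x, (f x - f z = q x * (x - z))%C.
Proof.
  intros H.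
  exists (fun x => if Ceq_dec x z then l else ((f x - f z) / (x - z))%C).
  assert (Hzz : (if Ceq_dec z z then l else (f z - f z) / (z - z))%C = l)
    by (destruct (Ceq_dec z z); congruence).
  split; [|split; [exact Hzz|]].
  - intros eps He. destruct (H eps He) as [d [Hd Hq]]. exists d. split; [exact Hd|].
    intros x Hx. rewrite Hzz. destruct (Ceq_dec x z) as [->|Hn].
    + replace (l - l)%C with (RtoC 0) by ring. now rewrite Cmod_0.
    + specialize (Hq (x - z)%C).
      change (Cadd z (x - z)%C) with (z + (x - z))%C in Hq.
      replace (z + (x - z))%C with x in Hq by ring.
      apply Hq; [|exact Hx]. intros E. apply Hn.
      change ((x - z)%C = 0) in E. replace x with ((x - z) + z)%C by ring. rewrite E. ring.
  - intros x. destruct (Ceq_dec x z) as [->|Hn]; [ring|]. field.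
    intros E. apply Hn. replace x with ((x - z) + z)%C by ring. rewrite E. ring.
Qed.

(** Converse of [cderiv_slope]. The factorization is asked only near z, since for the reciprocal and
    for the inverse of the cubic it is available only on a disc. *)
Lemma slope_cderiv (f q : C -> C) (z l : C) (d : R) : 0 < d -> ccont q z -> q z = l ->
  (forall x, Cmod (x - z) < d -> (f x - f z = q x * (x - z))%C) -> has_cderiv f z l.
Proof.
  intros Hd Hq <- H eps He. destruct (Hq eps He) as [d' [Hd' Hq']].
  exists (Rmin d d'). split; [now apply Rmin_pos|]. intros h Hh Hl.
  change (Cnorm h) with (Cmod h) in Hl.
  change (h <> RtoC 0) in Hh.
  change (Cmod ((f (z + h) - f z) / h - q z) < eps)%C.
  assert (E : ((z + h) - z = h)%C) by ring.
  rewrite (H (z + h)%C); rewrite E; [|eapply Rlt_le_trans; [exact Hl|apply Rmin_l]].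
  replace (q (z + h) * h / h)%C with (q (z + h)%C) by (field; exact Hh).
  apply Hq'. rewrite E. eapply Rlt_le_trans; [exact Hl|apply Rmin_r].
Qed.

Lemma cderiv_ccont (f : C -> C) (z l : C) : has_cderiv f z l -> ccont f z.
Proof.
  intros H. destruct (cderiv_slope f z l H) as [q [Hq [_ E]]].
  assert (Hc : ccont (fun x => f z + q x * (x + - z))%C z).
  { apply ccont_plus; [apply ccont_const|]. apply ccont_mult; [exact Hq|].
    apply ccont_plus; [apply ccont_id|apply ccont_const]. }
  intros eps He. destruct (Hc eps He) as [d [Hd Hx]]. exists d. split; [exact Hd|].
  intros x Hl. specialize (Hx x Hl). rewrite E.
  replace (q x * (x - z))%C
    with (f z + q x * (x + - z) - (f z + q z * (z + - z)))%C by ring. exact Hx.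
Qed.

Lemma cderiv_unique (f : C -> C) (z l1 l2 : C) :
  has_cderiv f z l1 -> has_cderiv f z l2 -> l1 = l2.
Proof.
  intros H1 H2. destruct (Ceq_dec l1 l2) as [E|N]; [exact E|exfalso].
  assert (Hm : 0 < Cmod (l1 - l2)).
  { apply Cmod_gt_0. intros E. apply N. replace l1 with ((l1 - l2) + l2)%C by ring.
    rewrite E. ring. }
  destruct (H1 (Cmod (l1 - l2) / 2) ltac:(lra)) as [d1 [Hd1 K1]].
  destruct (H2 (Cmod (l1 - l2) / 2) ltac:(lra)) as [d2 [Hd2 K2]].
  pose (d := Rmin d1 d2). assert (Hd : 0 < d) by now apply Rmin_pos.
  pose (h := RtoC (d / 2)).
  assert (Hh : h <> RtoC 0) by (intros E; apply RtoC_inj in E; lra).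
  assert (Hn : Cmod h = d / 2) by (unfold h; rewrite Cmod_R; apply Rabs_pos_eq; lra).
  assert (D1 : d <= d1) by apply Rmin_l. assert (D2 : d <= d2) by apply Rmin_r.
  assert (A1 : Cmod h < d1) by lra. assert (A2 : Cmod h < d2) by lra.
  specialize (K1 h Hh A1). specialize (K2 h Hh A2).
  set (s := ((f (z + h) - f z) / h)%C).
  change (Cmod (s - l1) < Cmod (l1 - l2) / 2) in K1.
  change (Cmod (s - l2) < Cmod (l1 - l2) / 2) in K2.
  assert (Cmod (l1 - l2) <= Cmod (s - l2) + Cmod (s - l1)).
  { rewrite <- (Cmod_opp (s - l1)).
    replace (l1 - l2)%C with ((s - l2) + - (s - l1))%C by ring. apply Cmod_triangle. }
  lra.
Qed.

Lemma cderiv_eq (f : C -> C) (z l l' : C) : has_cderiv f z l -> l = l' -> has_cderiv f z l'.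
Proof. intros H <-. exact H. Qed.

Lemma cderiv_const (c z : C) : has_cderiv (fun _ => c) z (RtoC 0).
Proof.
  apply slope_cderiv with (q := fun _ => RtoC 0) (d := 1); try lra; auto.
  - apply ccont_const.
  - intros. ring.
Qed.

Lemma cderiv_id (z : C) : has_cderiv (fun x => x) z (RtoC 1).
Proof.
  apply slope_cderiv with (q := fun _ => RtoC 1) (d := 1); try lra; auto.
  - apply ccont_const.
  - intros. ring.
Qed.

Lemma cderiv_plus (f g : C -> C) (z l m : C) :
  has_cderiv f z l -> has_cderiv g z m -> has_cderiv (fun x => f x + g x)%C z (l + m)%C.
Proof.
  intros Hf Hg. destruct (cderiv_slope _ _ _ Hf) as [p [Hp [<- Ep]]].
  destruct (cderiv_slope _ _ _ Hg) as [q [Hq [<- Eq]]].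
  apply slope_cderiv with (q := fun x => (p x + q x)%C) (d := 1); try lra; auto.
  - now apply ccont_plus.
  - intros x _. replace (f x + g x - (f z + g z))%C with ((f x - f z) + (g x - g z))%C by ring.
    rewrite Ep, Eq. ring.
Qed.

Lemma cderiv_mult (f g : C -> C) (z l m : C) :
  has_cderiv f z l -> has_cderiv g z m ->
  has_cderiv (fun x => f x * g x)%C z (l * g z + f z * m)%C.
Proof.
  intros Hf Hg. pose proof (cderiv_ccont _ _ _ Hg) as Cg.
  destruct (cderiv_slope _ _ _ Hf) as [p [Hp [<- Ep]]].
  destruct (cderiv_slope _ _ _ Hg) as [q [Hq [<- Eq]]].
  apply slope_cderiv with (q := fun x => (p x * g x + f z * q x)%C) (d := 1); try lra; auto.
  - apply ccont_plus; apply ccont_mult; auto. apply ccont_const.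
  - intros x _.
    replace (f x * g x - f z * g z)%C with ((f x - f z) * g x + f z * (g x - g z))%C by ring.
    rewrite Ep, Eq. ring.
Qed.

Lemma cderiv_comp (f g : C -> C) (z l m : C) :
  has_cderiv g z m -> has_cderiv f (g z) l -> has_cderiv (fun x => f (g x)) z (l * m)%C.
Proof.
  intros Hg Hf. pose proof (cderiv_ccont _ _ _ Hg) as Cg.
  destruct (cderiv_slope _ _ _ Hf) as [p [Hp [<- Ep]]].
  destruct (cderiv_slope _ _ _ Hg) as [q [Hq [<- Eq]]].
  apply slope_cderiv with (q := fun x => (p (g x) * q x)%C) (d := 1); try lra; auto.
  - apply ccont_mult; auto. now apply ccont_comp.
  - intros x _. rewrite Ep, Eq. ring.
Qed.

Lemma cderiv_Cinv (z : C) : z <> 0 -> has_cderiv Cinv z (- / (z * z))%C.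
Proof.
  intros Hz.
  apply slope_cderiv with (q := fun x => (- (1) * (/ x * / z))%C) (d := Cmod z).
  - now apply Cmod_gt_0.
  - apply ccont_mult; [apply ccont_const|]. apply ccont_mult; [|apply ccont_const].
    apply ccont_inv; auto. apply ccont_id.
  - field. exact Hz.
  - intros x Hx. assert (x <> 0).
    { intros ->. replace (0 - z)%C with (- z)%C in Hx by ring. rewrite Cmod_opp in Hx. lra. }
    field. auto.
Qed.

Lemma cderiv_scal (f : C -> C) (c z l : C) :
  has_cderiv f z l -> has_cderiv (fun x => c * f x)%C z (c * l)%C.
Proof.
  intros H. eapply cderiv_eq; [exact (cderiv_mult _ _ _ _ _ (cderiv_const c z) H)|].
  cbv beta. ring.
Qed.

Lemma cderiv_div (f g : C -> C) (z l m : C) :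
  has_cderiv f z l -> has_cderiv g z m -> g z <> 0 ->
  has_cderiv (fun x => f x / g x)%C z ((l * g z - f z * m) / (g z * g z))%C.
Proof.
  intros Hf Hg Hz. eapply cderiv_eq.
  - exact (cderiv_mult _ _ _ _ _ Hf (cderiv_comp Cinv g z _ _ Hg (cderiv_Cinv _ Hz))).
  - cbv beta. field. exact Hz.
Qed.

Lemma cderiv_ex_pow (f : C -> C) (n : nat) (z l : C) :
  has_cderiv f z l -> exists m, has_cderiv (fun x => f x ^ n)%C z m.
Proof.
  intros H. induction n as [|n [m IH]]; simpl.
  - eexists. apply cderiv_const.
  - eexists. exact (cderiv_mult _ _ _ _ _ H IH).
Qed.

(** The Cauchy-Riemann equations in total-derivative form. The bisection argument needs a linear
    approximation in both variables at once, not mere partial derivatives. *)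
Lemma cderiv_differentiable (f : C -> C) (x y : R) (l : C) : has_cderiv f (x, y) l ->
  differentiable_pt_lim (fun u v => fst (f (u, v))) x y (fst l) (- snd l) /\
  differentiable_pt_lim (fun u v => snd (f (u, v))) x y (snd l) (fst l).
Proof.
  intros H. destruct (cderiv_slope _ _ _ H) as [q [Hq [<- E]]].
  (* One complex estimate, whose real and imaginary parts give the two claims. The factor 2 below
     dominates the sqrt 2 between modulus and maximum norm. *)
  assert (K : forall eps : posreal, exists d : posreal, forall u v, Rabs (u - x) < d ->
     Rabs (v - y) < d ->
     Cmod (f (u, v) - f (x, y) - q (x, y) * ((u, v) - (x, y)))%C
       <= eps * Rmax (Rabs (u - x)) (Rabs (v - y))).
  { intros eps. destruct (Hq (eps / 2)) as [d [Hd K]]; [destruct eps; simpl; lra|].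
    assert (Hd2 : 0 < d / 2) by lra. exists (mkposreal _ Hd2). simpl. intros u v Hu Hv.
    rewrite E.
    replace (q (u, v) * ((u, v) - (x, y)) - q (x, y) * ((u, v) - (x, y)))%C
      with ((q (u, v) - q (x, y)) * ((u, v) - (x, y)))%C by ring.
    rewrite Cmod_mult.
    assert (Hm : Cmod ((u, v) - (x, y)) <= 2 * Rmax (Rabs (u - x)) (Rabs (v - y))).
    { eapply Rle_trans; [apply Cmod_2Rmax|]. cbn [fst snd Cminus Cplus Copp].
      apply Rmult_le_compat_r.
      - eapply Rle_trans; [apply Rabs_pos|apply Rmax_l].
      - apply sqrt2_le_2. }
    assert (Hlt : Cmod ((u, v) - (x, y)) < d).
    { eapply Rle_lt_trans; [exact Hm|].
      apply Rmult_lt_reg_l with (/ 2); [lra|].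
      rewrite <- Rmult_assoc, Rinv_l, Rmult_1_l by lra.
      apply Rmax_lub_lt; lra. }
    specialize (K _ Hlt).
    replace (eps * Rmax (Rabs (u - x)) (Rabs (v - y)))
      with (eps / 2 * (2 * Rmax (Rabs (u - x)) (Rabs (v - y)))) by field.
    apply Rmult_le_compat; try apply Cmod_ge_0; lra. }
  split; intros eps; destruct (K eps) as [d Hd]; exists d; intros u v Hu Hv;
    eapply Rle_trans; [|exact (Hd u v Hu Hv)| |exact (Hd u v Hu Hv)].
  - eapply Rle_trans; [|apply re_le_Cmod]. right. f_equal. unfold Re. simpl. ring.
  - eapply Rle_trans; [|eapply Rle_trans; [apply Rmax_r|apply Rmax_Cmod]].
    right. f_equal. simpl. ring.
Qed.

Lemma differentiable_cderiv (f : C -> C) (x y a b : R) :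
  differentiable_pt_lim (fun u v => fst (f (u, v))) x y a (- b) ->
  differentiable_pt_lim (fun u v => snd (f (u, v))) x y b a ->
  has_cderiv f (x, y) (a, b).
Proof.
  intros H1 H2 eps He.
  (* An error of eps / 4 in each coordinate costs at most sqrt 2 * eps / 4 in modulus, strictly
     below eps. *)
  assert (He4 : 0 < eps / 4) by lra.
  destruct (H1 (mkposreal _ He4)) as [d1 K1].
  destruct (H2 (mkposreal _ He4)) as [d2 K2].
  exists (Rmin d1 d2). split; [apply Rmin_pos; [apply d1|apply d2]|].
  intros h Hh Hl. change (Cmod h < Rmin d1 d2) in Hl. change (h <> RtoC 0) in Hh.
  change (Cmod ((f ((x, y) + h) - f (x, y)) / h - (a, b)) < eps)%C.
  set (m := Rmax (Rabs (fst h)) (Rabs (snd h))).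
  assert (Hm : m <= Cmod h) by apply Rmax_Cmod.
  assert (Hm0 : 0 < Cmod h) by now apply Cmod_gt_0.
  assert (B1 : Rabs (fst h) <= m) by apply Rmax_l.
  assert (B2 : Rabs (snd h) <= m) by apply Rmax_r.
  pose proof (Rmin_l d1 d2). pose proof (Rmin_r d1 d2).
  destruct h as [p q].
  specialize (K1 (x + p) (y + q)). specialize (K2 (x + p) (y + q)).
  replace (x + p - x) with p in * by ring. replace (y + q - y) with q in * by ring.
  cbn [fst snd pos] in *. fold m in K1, K2.
  specialize (K1 ltac:(lra) ltac:(lra)). specialize (K2 ltac:(lra) ltac:(lra)).
  replace ((f ((x, y) + (p, q)) - f (x, y)) / (p, q) - (a, b))%C
    with ((f ((x, y) + (p, q)) - f (x, y) - (a, b) * (p, q)) / (p, q))%C by (field; exact Hh).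
  rewrite Cmod_div by exact Hh.
  apply Rmult_lt_reg_r with (Cmod (p, q)); [exact Hm0|].
  unfold Rdiv. rewrite Rmult_assoc, Rinv_l, Rmult_1_r by lra.
  set (X := (f ((x, y) + (p, q)) - f (x, y) - (a, b) * (p, q))%C).
  assert (X1 : Rabs (fst X) <= eps / 4 * m).
  { eapply Rle_trans; [|exact K1]. right. f_equal. unfold X. simpl. unfold Cplus. simpl. ring. }
  assert (X2 : Rabs (snd X) <= eps / 4 * m).
  { eapply Rle_trans; [|exact K2]. right. f_equal. unfold X. simpl. unfold Cplus. simpl. ring. }
  eapply Rle_lt_trans; [apply Cmod_2Rmax|].
  pose proof sqrt2_le_2.
  assert (Rmax (Rabs (fst X)) (Rabs (snd X)) <= eps / 4 * m) by now apply Rmax_lub.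
  assert (0 <= Rmax (Rabs (fst X)) (Rabs (snd X)))
    by (eapply Rle_trans; [apply Rabs_pos|apply Rmax_l]).
  pose proof (sqrt_pos 2). nra.
Qed.

(** * Goursat's theorem on rectangles *)

(** The integral of P dx + Q dy along the boundary of [a,b] x [c,d], counterclockwise. *)
Definition circulation (P Q : R -> R -> R) (a b c d : R) : R :=
  (RInt (fun x => P x c) a b - RInt (fun x => P x d) a b) +
  (RInt (fun y => Q b y) c d - RInt (fun y => Q a y) c d).

Lemma continuity_2d_fst (P : R -> R -> R) (x y : R) :
  continuity_2d_pt P x y -> continuous (fun u => P u y) x.
Proof.
  intros H. apply continuity_pt_filterlim. intros eps He.
  destruct (H (mkposreal _ He)) as [d Hd]. exists d. split; [apply d|].
  intros u [_ Hu]. apply Hd; [exact Hu|]. rewrite Rminus_diag, Rabs_R0. apply d.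
Qed.

Lemma continuity_2d_snd (P : R -> R -> R) (x y : R) :
  continuity_2d_pt P x y -> continuous (fun v => P x v) y.
Proof.
  intros H. apply continuity_pt_filterlim. intros eps He.
  destruct (H (mkposreal _ He)) as [d Hd]. exists d. split; [apply d|].
  intros v [_ Hv]. apply Hd; [|exact Hv]. rewrite Rminus_diag, Rabs_R0. apply d.
Qed.

Lemma ex_RInt_row (P : R -> R -> R) (a b y : R) : a <= b ->
  (forall x, a <= x <= b -> continuity_2d_pt P x y) -> ex_RInt (fun x => P x y) a b.
Proof.
  intros Hab H. apply (ex_RInt_continuous (V := R_CompleteNormedModule)).
  rewrite Rmin_left, Rmax_right by lra. intros z Hz. now apply continuity_2d_fst, H.
Qed.

Lemma ex_RInt_col (P : R -> R -> R) (c d x : R) : c <= d ->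
  (forall y, c <= y <= d -> continuity_2d_pt P x y) -> ex_RInt (fun y => P x y) c d.
Proof.
  intros Hab H. apply (ex_RInt_continuous (V := R_CompleteNormedModule)).
  rewrite Rmin_left, Rmax_right by lra. intros z Hz. now apply continuity_2d_snd, H.
Qed.

Lemma RInt_split (f : R -> R) (a m b : R) : a <= m <= b -> ex_RInt f a b ->
  RInt f a b = RInt f a m + RInt f m b.
Proof.
  intros Hm H. symmetry. apply (RInt_Chasles f a m b).
  - now apply ex_RInt_Chasles_1 with b.
  - now apply ex_RInt_Chasles_2 with a.
Qed.

(** Each inner segment is run through twice in opposite directions and cancels. *)
Lemma circulation_split (P Q : R -> R -> R) (a b c d m n : R) : a <= m <= b -> c <= n <= d ->
  (forall x y, a <= x <= b -> c <= y <= d -> continuity_2d_pt P x y) ->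
  (forall x y, a <= x <= b -> c <= y <= d -> continuity_2d_pt Q x y) ->
  circulation P Q a b c d =
    circulation P Q a m c n + circulation P Q m b c n + circulation P Q a m n d + circulation P Q m b n d.
Proof.
  intros Hm Hn HP HQ. unfold circulation.
  rewrite (RInt_split (fun x => P x c) a m b), (RInt_split (fun x => P x d) a m b),
    (RInt_split (fun y => Q b y) c n d), (RInt_split (fun y => Q a y) c n d); try lra.
  - apply ex_RInt_col; [lra|]. intros. apply HQ; lra.
  - apply ex_RInt_col; [lra|]. intros. apply HQ; lra.
  - apply ex_RInt_row; [lra|]. intros. apply HP; lra.
  - apply ex_RInt_row; [lra|]. intros. apply HP; lra.
Qed.

Lemma RInt_diff_const (f g : R -> R) (a b k e : R) : a <= b -> ex_RInt f a b -> ex_RInt g a b ->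
  (forall x, a <= x <= b -> Rabs (f x - g x - k) <= e) ->
  Rabs (RInt f a b - RInt g a b - k * (b - a)) <= (b - a) * e.
Proof.
  intros Hab Hf Hg H.
  assert (Hfg : ex_RInt (fun x => f x - g x) a b) by now apply (ex_RInt_minus f g).
  assert (Hk : ex_RInt (fun _ => k) a b) by apply ex_RInt_const.
  assert (E : RInt f a b - RInt g a b - k * (b - a) = RInt (fun x => f x - g x - k) a b).
  { rewrite (RInt_minus (fun x => f x - g x) (fun _ => k)) by assumption.
    rewrite (RInt_minus f g) by assumption. rewrite RInt_const.
    unfold minus, plus, opp, scal; simpl; unfold mult; simpl. ring. }
  rewrite E. apply abs_RInt_le_const; auto.
  now apply (ex_RInt_minus (fun x => f x - g x) (fun _ => k)).
Qed.

(** The cross coefficient k is common to P and Q, so its contributions k (c - d)(b - a) and k (b -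
    a)(d - c) cancel. What remains is at most 2 e s on each pair of opposite sides, over a length at
    most s. *)
Lemma circulation_affine_bound (P Q : R -> R -> R) (a b c d p q px k qy e s : R) :
  a <= b -> c <= d -> b - a <= s -> d - c <= s ->
  (forall x y, a <= x <= b -> c <= y <= d -> continuity_2d_pt P x y) ->
  (forall x y, a <= x <= b -> c <= y <= d -> continuity_2d_pt Q x y) ->
  (forall x y, a <= x <= b -> c <= y <= d ->
     Rabs (P x y - P p q - (px * (x - p) + k * (y - q))) <= e * s) ->
  (forall x y, a <= x <= b -> c <= y <= d ->
     Rabs (Q x y - Q p q - (k * (x - p) + qy * (y - q))) <= e * s) ->
  Rabs (circulation P Q a b c d) <= 4 * e * s ^ 2.
Proof.
  intros Hab Hcd Hs1 Hs2 CP CQ HP HQ.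
  assert (Hes : 0 <= e * s).
  { eapply Rle_trans; [apply Rabs_pos|apply (HP a c); lra]. }
  assert (B1 : Rabs (RInt (fun x => P x c) a b - RInt (fun x => P x d) a b
                     - (k * (c - d)) * (b - a)) <= (b - a) * (2 * (e * s))).
  { apply RInt_diff_const; auto.
    - apply ex_RInt_row; auto. intros. apply CP; lra.
    - apply ex_RInt_row; auto. intros. apply CP; lra.
    - intros x Hx.
      pose proof (HP x c Hx ltac:(lra)) as H1. pose proof (HP x d Hx ltac:(lra)) as H2.
      apply Rabs_le_between in H1. apply Rabs_le_between in H2.
      apply Rabs_le_between. split; lra. }
  assert (B2 : Rabs (RInt (fun y => Q b y) c d - RInt (fun y => Q a y) c d
                     - (k * (b - a)) * (d - c)) <= (d - c) * (2 * (e * s))).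
  { apply RInt_diff_const; auto.
    - apply ex_RInt_col; auto. intros. apply CQ; lra.
    - apply ex_RInt_col; auto. intros. apply CQ; lra.
    - intros y Hy.
      pose proof (HQ b y ltac:(lra) Hy) as H1. pose proof (HQ a y ltac:(lra) Hy) as H2.
      apply Rabs_le_between in H1. apply Rabs_le_between in H2.
      apply Rabs_le_between. split; lra. }
  assert (M1 : (b - a) * (2 * (e * s)) <= s * (2 * (e * s))) by (apply Rmult_le_compat_r; lra).
  assert (M2 : (d - c) * (2 * (e * s)) <= s * (2 * (e * s))) by (apply Rmult_le_compat_r; lra).
  apply Rabs_le_between in B1. apply Rabs_le_between in B2.
  unfold circulation. apply Rabs_le_between. split; lra.
Qed.

(** The supremum of the left ends lies in every interval. *)
Lemma nested_intervals (x w : nat -> R) :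
  (forall n, x n <= x (S n)) -> (forall n, x (S n) + w (S n) <= x n + w n) ->
  (forall n, 0 <= w n) -> exists p, forall n, x n <= p <= x n + w n.
Proof.
  intros Hx Hw H0.
  assert (M1 : forall n k, x n <= x (n + k)%nat).
  { intros n k. induction k; [rewrite Nat.add_0_r; lra|]. rewrite Nat.add_succ_r.
    specialize (Hx (n + k)%nat). lra. }
  assert (M2 : forall n k, x (n + k)%nat + w (n + k)%nat <= x n + w n).
  { intros n k. induction k; [rewrite Nat.add_0_r; lra|]. rewrite Nat.add_succ_r.
    specialize (Hw (n + k)%nat). lra. }
  assert (B : forall n m, x n <= x m + w m).
  { intros n m. pose proof (M1 n m) as K1. pose proof (M2 m n) as K2.
    rewrite (Nat.add_comm m n) in K2. specialize (H0 (n + m)%nat). lra. }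
  destruct (completeness (fun r => exists n, r = x n)) as [p [Hp1 Hp2]].
  - exists (x 0%nat + w 0%nat). intros r [n ->]. apply B.
  - exists (x 0%nat). now exists 0%nat.
  - exists p. intros n. split.
    + apply Hp1. now exists n.
    + apply Hp2. intros r [m ->]. apply B.
Qed.

Lemma differentiable_pt_lim_continuity (f : R -> R -> R) (x y a b : R) :
  differentiable_pt_lim f x y a b -> continuity_2d_pt f x y.
Proof. intros H. apply differentiable_continuity_pt. now exists a, b. Qed.

Section Goursat.
Variables P Q : R -> R -> R.
Variables a W c H : R.
Hypothesis HW : 0 <= W.
Hypothesis HH : 0 <= H.
(** The shared k says dP/dy = dQ/dx: the form P dx + Q dy is closed. These derivatives are not
    assumed continuous, hence bisection instead of Green's formula. *)
Hypothesis HPQ : forall x y, a <= x <= a + W -> c <= y <= c + H ->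
  exists px k qy, differentiable_pt_lim P x y px k /\ differentiable_pt_lim Q x y k qy.

Let w (n : nat) : R := W * (/ 2) ^ n.
Let h (n : nat) : R := H * (/ 2) ^ n.
Let I (n : nat) (z : R * R) : R :=
  circulation P Q (fst z) (fst z + w n) (snd z) (snd z + h n).

(** Selects a quarter that carries at least a quarter of the circulation. The last one is taken
    untested; [step_big] shows that it qualifies when the other three fail. *)
Let step (n : nat) (z : R * R) : R * R :=
  let big z' := Rle_dec (Rabs (I n z) / 4) (Rabs (I (S n) z')) in
  let z1 := (fst z + w (S n), snd z) in
  let z2 := (fst z, snd z + h (S n)) in
  let z3 := (fst z + w (S n), snd z + h (S n)) in
  if big z then z else if big z1 then z1 else if big z2 then z2 else z3.

Let corner (n : nat) : R * R := nat_rect (fun _ => (R * R)%type) (a, c) step n.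

Let wS n : w n = 2 * w (S n).
Proof. unfold w. simpl. field. Qed.
Let hS n : h n = 2 * h (S n).
Proof. unfold h. simpl. field. Qed.
Let w_pos n : 0 <= w n.
Proof. unfold w. apply Rmult_le_pos; [exact HW|]. apply pow_le. lra. Qed.
Let h_pos n : 0 <= h n.
Proof. unfold h. apply Rmult_le_pos; [exact HH|]. apply pow_le. lra. Qed.

Let CP x y : a <= x <= a + W -> c <= y <= c + H -> continuity_2d_pt P x y.
Proof.
  intros Hx Hy. destruct (HPQ x y Hx Hy) as [px [k [qy [H1 _]]]].
  eapply differentiable_pt_lim_continuity, H1.
Qed.
Let CQ x y : a <= x <= a + W -> c <= y <= c + H -> continuity_2d_pt Q x y.
Proof.
  intros Hx Hy. destruct (HPQ x y Hx Hy) as [px [k [qy [_ H1]]]].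
  eapply differentiable_pt_lim_continuity, H1.
Qed.

Let step_in n z :
  fst z <= fst (step n z) /\ fst (step n z) + w (S n) <= fst z + w n /\
  snd z <= snd (step n z) /\ snd (step n z) + h (S n) <= snd z + h n.
Proof.
  pose proof (w_pos (S n)). pose proof (h_pos (S n)). pose proof (wS n). pose proof (hS n).
  unfold step. repeat destruct (Rle_dec _ _); simpl; repeat split; lra.
Qed.

Let corner_in n :
  a <= fst (corner n) /\ fst (corner n) + w n <= a + W /\
  c <= snd (corner n) /\ snd (corner n) + h n <= c + H.
Proof.
  induction n as [|n IH].
  - unfold w, h. simpl. repeat split; lra.
  - change (corner (S n)) with (step n (corner n)).
    pose proof (step_in n (corner n)). lra.
Qed.

Let step_big n : Rabs (I n (corner n)) / 4 <= Rabs (I (S n) (corner (S n))).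
Proof.
  change (corner (S n)) with (step n (corner n)).
  pose proof (corner_in n) as Hin. set (z := corner n) in *.
  pose proof (w_pos (S n)). pose proof (h_pos (S n)). pose proof (wS n). pose proof (hS n).
  assert (E : I n z = I (S n) z + I (S n) (fst z + w (S n), snd z)
     + I (S n) (fst z, snd z + h (S n)) + I (S n) (fst z + w (S n), snd z + h (S n))).
  { unfold I. simpl fst. simpl snd.
    rewrite (circulation_split P Q (fst z) (fst z + w n) (snd z) (snd z + h n)
               (fst z + w (S n)) (snd z + h (S n))); try lra.
    - replace (fst z + w (S n) + w (S n)) with (fst z + w n) by lra.
      replace (snd z + h (S n) + h (S n)) with (snd z + h n) by lra. reflexivity.
    - intros. apply CP; lra.
    - intros. apply CQ; lra. }
  (* Only the untested quarter survives: three parts below |I|/4 force the fourth to reach it. *)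
  unfold step. repeat destruct (Rle_dec _ _); try assumption.
  assert (T : Rabs (I n z) <= Rabs (I (S n) z) + Rabs (I (S n) (fst z + w (S n), snd z))
     + Rabs (I (S n) (fst z, snd z + h (S n)))
     + Rabs (I (S n) (fst z + w (S n), snd z + h (S n)))).
  { rewrite E at 1. eapply Rle_trans; [apply Rabs_triang|]. apply Rplus_le_compat_r.
    eapply Rle_trans; [apply Rabs_triang|]. apply Rplus_le_compat_r. apply Rabs_triang. }
  lra.
Qed.

Let corner_big n : Rabs (circulation P Q a (a + W) c (c + H)) * (/ 4) ^ n <= Rabs (I n (corner n)).
Proof.
  induction n as [|n IH].
  - unfold I, w, h, corner. simpl. rewrite !Rmult_1_r. apply Rle_refl.
  - pose proof (step_big n). rewrite <- tech_pow_Rmult. lra.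
Qed.

Lemma goursat_rectangle : circulation P Q a (a + W) c (c + H) = 0.
Proof.
  destruct (nested_intervals (fun n => fst (corner n)) w) as [p Hp]; auto.
  { intros n. apply (step_in n (corner n)). }
  { intros n. apply (step_in n (corner n)). }
  destruct (nested_intervals (fun n => snd (corner n)) h) as [q Hq]; auto.
  { intros n. apply (step_in n (corner n)). }
  { intros n. apply (step_in n (corner n)). }
  assert (Hpq : a <= p <= a + W /\ c <= q <= c + H).
  { specialize (Hp 0%nat). specialize (Hq 0%nat). unfold w, h in *. simpl in *. lra. }
  destruct (HPQ p q) as [px [k [qy [DP DQ]]]]; try apply Hpq.
  set (s := fun n => (W + H) * (/ 2) ^ n).
  assert (Hws : forall n, w n <= s n /\ h n <= s n).
  { intros n. assert (E : s n = w n + h n) by (unfold s, w, h; ring).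
    pose proof (w_pos n). pose proof (h_pos n). lra. }
  set (X := Rabs (circulation P Q a (a + W) c (c + H))).
  (* Bisection keeps |I_n| >= X / 4^n, while the affine approximation at (p, q) gives |I_n| <= 4 e
     (W + H)^2 / 4^n; the powers of 4 cancel. *)
  assert (Key : forall e : posreal, X <= e * (4 * (W + H) ^ 2)).
  { intros e. destruct (DP e) as [d1 K1]. destruct (DQ e) as [d2 K2].
    assert (Hd : 0 < Rmin d1 d2) by (apply Rmin_pos; [apply d1|apply d2]).
    assert (Hy : 0 < Rmin d1 d2 / (W + H + 1)) by (apply Rdiv_lt_0_compat; lra).
    destruct (pow_lt_1_zero (/ 2) ltac:(rewrite Rabs_pos_eq; lra) _ Hy) as [n Hn].
    specialize (Hn n (le_n n)). rewrite Rabs_pos_eq in Hn by (apply pow_le; lra).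
    assert (Hsn : s n < Rmin d1 d2).
    { assert (0 < (/ 2) ^ n) by (apply pow_lt; lra).
      apply Rle_lt_trans with ((W + H + 1) * (/ 2) ^ n); [unfold s; nra|].
      apply Rmult_lt_compat_l with (r := W + H + 1) in Hn; [|lra].
      replace ((W + H + 1) * (Rmin d1 d2 / (W + H + 1))) with (Rmin d1 d2) in Hn
        by (field; lra). exact Hn. }
    pose proof (Rmin_l d1 d2). pose proof (Rmin_r d1 d2).
    pose proof (corner_in n) as Hin. specialize (Hp n). specialize (Hq n).
    specialize (Hws n). pose proof (w_pos n). pose proof (h_pos n).
    assert (Hclose : forall x y, fst (corner n) <= x <= fst (corner n) + w n ->
       snd (corner n) <= y <= snd (corner n) + h n ->
       Rabs (x - p) <= s n /\ Rabs (y - q) <= s n).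
    { intros x y Hx Hy'. split; apply Rabs_le_between; lra. }
    assert (Bd : Rabs (I n (corner n)) <= 4 * e * s n ^ 2).
    { unfold I. apply circulation_affine_bound with (p := p) (q := q) (px := px) (k := k) (qy := qy);
        try lra.
      - intros. apply CP; lra.
      - intros. apply CQ; lra.
      - intros x y Hx Hy'. destruct (Hclose x y Hx Hy') as [C1 C2].
        eapply Rle_trans; [apply K1; lra|]. apply Rmult_le_compat_l; [left; apply e|].
        now apply Rmax_lub.
      - intros x y Hx Hy'. destruct (Hclose x y Hx Hy') as [C1 C2].
        eapply Rle_trans; [apply K2; lra|]. apply Rmult_le_compat_l; [left; apply e|].
        now apply Rmax_lub. }
    pose proof (corner_big n) as Big. fold X in Big.
    assert (E4 : s n ^ 2 = (W + H) ^ 2 * (/ 4) ^ n).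
    { unfold s. rewrite Rpow_mult_distr. f_equal. rewrite <- pow_mult, Nat.mul_comm, pow_mult.
      f_equal. field. }
    rewrite E4 in Bd.
    assert (P4 : 0 < (/ 4) ^ n) by (apply pow_lt; lra).
    apply Rmult_le_reg_r with ((/ 4) ^ n); [exact P4|]. lra. }
  assert (HX : 0 <= X) by apply Rabs_pos.
  destruct (Req_dec X 0) as [E|N].
  - apply Rabs_eq_0. exact E.
  - exfalso. assert (K0 : 0 <= 4 * (W + H) ^ 2) by nra.
    (* The + 1 keeps the denominator positive even for a degenerate rectangle. *)
    assert (He : 0 < X / (2 * (4 * (W + H) ^ 2 + 1))) by (apply Rdiv_lt_0_compat; lra).
    specialize (Key (mkposreal _ He)). cbn [pos] in Key.
    set (T := 4 * (W + H) ^ 2) in *.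
    assert (HX0 : 0 < X) by lra. assert (HXT : 0 <= X * T) by (apply Rmult_le_pos; lra).
    assert (X / (2 * (T + 1)) * T < X); [|now apply (Rle_not_lt _ _ Key)].
    apply Rmult_lt_reg_r with (2 * (T + 1)); [lra|].
    replace (X / (2 * (T + 1)) * T * (2 * (T + 1))) with (X * T) by (field; lra). lra.
Qed.

End Goursat.

(** * Maximum principle and Schwarz lemma *)

Lemma differentiable_pt_lim_eq (f : R -> R -> R) (x y a b a' b' : R) :
  differentiable_pt_lim f x y a b -> a = a' -> b = b' -> differentiable_pt_lim f x y a' b'.
Proof. intros H <- <-. exact H. Qed.

Lemma differentiable_pt_lim_fst (x y : R) : differentiable_pt_lim (fun u _ => u) x y 1 0.
Proof. apply differentiable_pt_lim_proj1_0, derivable_pt_lim_id. Qed.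

Lemma differentiable_pt_lim_snd (x y : R) : differentiable_pt_lim (fun _ v => v) x y 0 1.
Proof.
  intros eps. exists eps. intros u v _ _.
  replace (v - y - (0 * (u - x) + 1 * (v - y))) with 0 by ring. rewrite Rabs_R0.
  apply Rmult_le_pos; [left; apply eps|]. eapply Rle_trans; [apply Rabs_pos|apply Rmax_l].
Qed.

Lemma differentiable_pt_lim_comp1 (h : R -> R) (g : R -> R -> R) (x y a b h' : R) :
  derivable_pt_lim h (g x y) h' -> differentiable_pt_lim g x y a b ->
  differentiable_pt_lim (fun u v => h (g u v)) x y (h' * a) (h' * b).
Proof.
  intros Hh Hg. eapply differentiable_pt_lim_eq.
  (* The binary chain rule, with an outer function that ignores its second argument. *)
  - apply (differentiable_pt_lim_comp (fun u _ => h u) g g).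
    + apply differentiable_pt_lim_proj1_0, Hh.
    + exact Hg.
    + exact Hg.
  - cbv beta; ring.
  - cbv beta; ring.
Qed.

Lemma differentiable_pt_lim_mul (f g : R -> R -> R) (x y a b a' b' : R) :
  differentiable_pt_lim f x y a b -> differentiable_pt_lim g x y a' b' ->
  differentiable_pt_lim (fun u v => f u v * g u v) x y
    (a * g x y + f x y * a') (b * g x y + f x y * b').
Proof.
  intros Hf Hg. eapply differentiable_pt_lim_eq.
  - apply (differentiable_pt_lim_comp (fun u v => u * v) f g x y (g x y) (f x y)); eauto.
    (* The remainder is the product of the two increments, so the tolerance itself serves as
       radius. *)
    intros eps. exists eps. intros u v Hu Hv.
    replace (u * v - f x y * g x y - (g x y * (u - f x y) + f x y * (v - g x y)))
      with ((u - f x y) * (v - g x y)) by ring.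
    rewrite Rabs_mult. apply Rmult_le_compat; try apply Rabs_pos; [lra|apply Rmax_r].
  - cbv beta; ring.
  - cbv beta; ring.
Qed.

Lemma differentiable_pt_lim_add (f g : R -> R -> R) (x y a b a' b' : R) :
  differentiable_pt_lim f x y a b -> differentiable_pt_lim g x y a' b' ->
  differentiable_pt_lim (fun u v => f u v + g u v) x y (a + a') (b + b').
Proof.
  intros Hf Hg. eapply differentiable_pt_lim_eq.
  - apply (differentiable_pt_lim_comp (fun u v => u + v) f g x y 1 1); eauto.
    intros eps. exists eps. intros u v Hu Hv.
    replace (u + v - (f x y + g x y) - (1 * (u - f x y) + 1 * (v - g x y))) with 0 by ring.
    rewrite Rabs_R0. apply Rmult_le_pos; [left; apply eps|].
    eapply Rle_trans; [apply Rabs_pos|apply Rmax_l].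
  - cbv beta; ring.
  - cbv beta; ring.
Qed.

Lemma differentiable_pt_lim_exp_cos (s t : R) :
  differentiable_pt_lim (fun u v => exp u * cos v) s t (exp s * cos t) (- (exp s * sin t)).
Proof.
  eapply differentiable_pt_lim_eq.
  - apply differentiable_pt_lim_mul; apply differentiable_pt_lim_comp1.
    + apply derivable_pt_lim_exp.
    + apply differentiable_pt_lim_fst.
    + apply derivable_pt_lim_cos.
    + apply differentiable_pt_lim_snd.
  - cbv beta; ring.
  - cbv beta; ring.
Qed.

Lemma differentiable_pt_lim_exp_sin (s t : R) :
  differentiable_pt_lim (fun u v => exp u * sin v) s t (exp s * sin t) (exp s * cos t).
Proof.
  eapply differentiable_pt_lim_eq.
  - apply differentiable_pt_lim_mul; apply differentiable_pt_lim_comp1.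
    + apply derivable_pt_lim_exp.
    + apply differentiable_pt_lim_fst.
    + apply derivable_pt_lim_sin.
    + apply differentiable_pt_lim_snd.
  - cbv beta; ring.
  - cbv beta; ring.
Qed.

(** * Integrals over circles, the maximum principle and the Schwarz lemma *)

Lemma Cmod_exp_polar (s t : R) : Cmod (exp s * cos t, exp s * sin t) = exp s.
Proof.
  unfold Cmod. simpl fst. simpl snd.
  replace ((exp s * cos t) ^ 2 + (exp s * sin t) ^ 2) with (exp s * exp s).
  - apply sqrt_square. left. apply exp_pos.
  - pose proof (sin2_cos2 t) as E. unfold Rsqr in E.
    replace ((exp s * cos t) ^ 2 + (exp s * sin t) ^ 2)
      with (exp s * exp s * (sin t * sin t + cos t * cos t)) by ring.
    rewrite E. ring.
Qed.

Lemma Cminus_0_r (z : C) : (z - 0)%C = z.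
Proof. ring. Qed.

(* In the coordinates z = e^s e^(it) the form [Im G ds + Re G dt] is closed and 2 pi-periodic
   in t, so the integral of Re G over a circle does not depend on the radius; shrink it to 0. *)
Lemma holomorphic_Re_center_le (G : C -> C) (rho M : R) : 0 < rho ->
  (forall z, Cmod z <= rho -> exists l, has_cderiv G z l) ->
  (forall z, Cmod z = rho -> Re (G z) <= M) -> Re (G 0) <= M.
Proof.
  intros Hr HG HM. apply Rnot_lt_le. intros Hlt.
  set (e := (Re (G 0) - M) / 2). assert (He : 0 < e) by (unfold e; lra).
  destruct (HG 0) as [l0 Hl0]; [rewrite Cmod_0; lra|].
  destruct (cderiv_ccont _ _ _ Hl0 e He) as [d [Hd Hc]].
  (* On the inner circle Re G > Re G(0) - e by continuity. If rho <= d / 2, the two circles coincide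
     and the rectangle has width 0. *)
  set (r := Rmin (d / 2) rho).
  assert (Hr0 : 0 < r) by (apply Rmin_pos; lra).
  assert (Hrd : r <= d / 2) by apply Rmin_l. assert (Hrr : r <= rho) by apply Rmin_r.
  set (P := fun s t => snd (G (exp s * cos t, exp s * sin t))).
  set (Q := fun s t => fst (G (exp s * cos t, exp s * sin t))).
  (* Cauchy-Riemann in logarithmic polar coordinates: the t-derivative of Im G equals the
     s-derivative of Re G, which provides the common k. *)
  assert (HPQ : forall s t, s <= ln rho ->
     exists ps k qt, differentiable_pt_lim P s t ps k /\ differentiable_pt_lim Q s t k qt).
  { intros s t Hs. destruct (HG (exp s * cos t, exp s * sin t)) as [l Hl].
    { rewrite Cmod_exp_polar. rewrite <- (exp_ln rho) by lra.
      destruct (Req_dec s (ln rho)) as [->|N]; [lra|]. left. apply exp_increasing. lra. }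
    apply cderiv_differentiable in Hl. destruct Hl as [H1 H2].
    do 3 eexists. split.
    - eapply differentiable_pt_lim_eq.
      + apply (differentiable_pt_lim_comp _ _ _ _ _ _ _ _ _ _ _ H2
                 (differentiable_pt_lim_exp_cos s t) (differentiable_pt_lim_exp_sin s t)).
      + reflexivity.
      + reflexivity.
    - eapply differentiable_pt_lim_eq.
      + apply (differentiable_pt_lim_comp _ _ _ _ _ _ _ _ _ _ _ H1
                 (differentiable_pt_lim_exp_cos s t) (differentiable_pt_lim_exp_sin s t)).
      + cbv beta; ring.
      + reflexivity. }
  assert (Hln : ln r <= ln rho) by (destruct Hrr as [h| ->]; [left; now apply ln_increasing|lra]).
  pose proof PI_RGT_0 as Hpi.
  pose proof (goursat_rectangle P Q (ln r) (ln rho - ln r) 0 (2 * PI)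
    ltac:(lra) ltac:(lra)) as Gr.
  replace (ln r + (ln rho - ln r)) with (ln rho) in Gr by ring.
  replace (0 + 2 * PI) with (2 * PI) in Gr by ring.
  specialize (Gr ltac:(intros; apply HPQ; lra)). unfold circulation in Gr.
  (* By periodicity the sides t = 0 and t = 2 pi cancel, so Re G has the same integral over both
     circles. *)
  assert (EP : RInt (fun x => P x 0) (ln r) (ln rho) = RInt (fun x => P x (2 * PI)) (ln r) (ln rho)).
  { apply RInt_ext. intros x _. unfold P. now rewrite cos_2PI, sin_2PI, cos_0, sin_0. }
  rewrite EP in Gr.
  assert (CQ : forall s, s <= ln rho -> ex_RInt (fun t => Q s t) 0 (2 * PI)).
  { intros s Hs. apply ex_RInt_col; [lra|]. intros t _.
    destruct (HPQ s t Hs) as [? [? [? [_ H]]]].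
    eapply differentiable_pt_lim_continuity, H. }
  assert (B1 : RInt (fun t => Q (ln rho) t) 0 (2 * PI) <= RInt (fun _ => M) 0 (2 * PI)).
  { apply RInt_le; [lra|apply CQ; lra|apply ex_RInt_const|]. intros t _.
    apply HM. rewrite Cmod_exp_polar. apply exp_ln; lra. }
  assert (B2 : RInt (fun _ => Re (G 0) - e) 0 (2 * PI) <= RInt (fun t => Q (ln r) t) 0 (2 * PI)).
  { apply RInt_le; [lra|apply ex_RInt_const|apply CQ; lra|]. intros t _.
    specialize (Hc (exp (ln r) * cos t, exp (ln r) * sin t)).
    set (z := (exp (ln r) * cos t, exp (ln r) * sin t)) in *.
    assert (Hz : Cmod z = r) by (unfold z; rewrite Cmod_exp_polar; apply exp_ln; lra).
    rewrite Cminus_0_r in Hc. specialize (Hc ltac:(lra)).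
    pose proof (re_le_Cmod (G z - G 0)) as HR.
    assert (Habs : Rabs (Re (G z - G 0)) < e) by lra.
    apply Rabs_lt_between in Habs. unfold Re, Cminus, Cplus, Copp in Habs. simpl in Habs.
    change (Q (ln r) t) with (fst (G z)). unfold Re. simpl. lra. }
  rewrite RInt_const in B1. rewrite RInt_const in B2.
  unfold scal in B1, B2; simpl in B1, B2. unfold mult in B1, B2; simpl in B1, B2.
  assert ((2 * PI - 0) * (Re (G 0) - e) <= (2 * PI - 0) * M) by lra.
  assert (Re (G 0) - e <= M) by (apply Rmult_le_reg_l with (2 * PI - 0); lra).
  unfold e in *. lra.
Qed.

Lemma Cmod_conj_mul (z : C) : (Cconj z * z)%C = RtoC (Cmod z ^ 2).
Proof. rewrite Cmod2_conj. ring. Qed.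

(** Multiplication by the conjugate of G(0) turns the central value into |G(0)|^2, which reduces the
    modulus to the real part. *)
Lemma holomorphic_center_le (G : C -> C) (rho M : R) : 0 < rho ->
  (forall z, Cmod z <= rho -> exists l, has_cderiv G z l) ->
  (forall z, Cmod z = rho -> Cmod (G z) <= M) -> Cmod (G 0) <= M.
Proof.
  intros Hr HG HM.
  set (c := Cconj (G 0)). set (m := Cmod (G 0)). assert (Hm : 0 <= m) by apply Cmod_ge_0.
  assert (H : Re (c * G 0)%C <= m * M).
  { apply (holomorphic_Re_center_le (fun z => c * G z)%C rho); auto.
    - intros z Hz. destruct (HG z Hz) as [l Hl]. eexists. apply cderiv_scal, Hl.
    - intros z Hz. eapply Rle_trans; [apply Rle_abs|]. eapply Rle_trans; [apply re_le_Cmod|].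
      rewrite Cmod_mult. unfold c. rewrite Cmod_conj. apply Rmult_le_compat_l; auto. }
  unfold c in H. rewrite Cmod_conj_mul in H. unfold Re in H. simpl in H. fold m in H.
  destruct Hm as [Hm|Hm].
  - apply Rmult_le_reg_l with m; lra.
  (* If G(0) = 0, a single boundary point shows M >= 0. *)
  - rewrite <- Hm. eapply Rle_trans; [|apply (HM (RtoC rho))]; [apply Cmod_ge_0|].
    rewrite Cmod_R. apply Rabs_pos_eq. lra.
Qed.

(* The disc automorphism sending 0 to z0 moves an arbitrary point to the center. *)
Lemma maximum_modulus (F : C -> C) (rho M : R) : 0 < rho ->
  (forall z, Cmod z <= rho -> exists l, has_cderiv F z l) ->
  (forall z, Cmod z = rho -> Cmod (F z) <= M) ->
  forall z0, Cmod z0 < rho -> Cmod (F z0) <= M.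
Proof.
  intros Hr HF HM z0 H0.
  set (r2 := RtoC (rho ^ 2)).
  assert (Hr2 : 0 < rho ^ 2) by nra.
  set (N := fun z : C => (r2 * (z + z0))%C).
  set (D := fun z : C => (r2 + Cconj z0 * z)%C).
  set (T := fun z => (N z / D z)%C).
  assert (HD : forall z, Cmod z <= rho -> D z <> 0).
  { intros z Hz E.
    assert (E2 : Cmod r2 = Cmod (Cconj z0 * z)).
    { replace r2 with (D z - Cconj z0 * z)%C by (unfold D; ring). rewrite E.
      replace (0 - Cconj z0 * z)%C with (- (Cconj z0 * z))%C by ring. apply Cmod_opp. }
    rewrite Cmod_mult, Cmod_conj in E2. unfold r2 in E2. rewrite Cmod_R, Rabs_pos_eq in E2 by lra.
    pose proof (Cmod_ge_0 z). pose proof (Cmod_ge_0 z0). nra. }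
  (* The sign of the right-hand side shows that T maps the closed disc into itself; its vanishing
     for |z| = rho shows that T maps the circle into the circle. *)
  assert (HND : forall z, rho ^ 2 * Cmod (D z) ^ 2 - Cmod (N z) ^ 2 =
      rho ^ 2 * ((rho ^ 2 - Cmod z ^ 2) * (rho ^ 2 - Cmod z0 ^ 2))).
  { intros [x y]. destruct z0 as [a b]. rewrite !Cmod2_alt. unfold D, N, r2, Re, Im. simpl. ring. }
  assert (HT : forall z, Cmod z <= rho -> Cmod (T z) <= rho /\ (Cmod z = rho -> Cmod (T z) = rho)).
  { intros z Hz. unfold T. rewrite Cmod_div by auto.
    assert (Hd : 0 < Cmod (D z)) by (apply Cmod_gt_0; auto).
    specialize (HND z). pose proof (Cmod_ge_0 z). pose proof (Cmod_ge_0 z0).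
    pose proof (Cmod_ge_0 (N z)).
    assert (K : 0 <= (rho ^ 2 - Cmod z ^ 2) * (rho ^ 2 - Cmod z0 ^ 2))
      by (apply Rmult_le_pos; nra).
    split.
    - apply Rmult_le_reg_r with (Cmod (D z)); [exact Hd|].
      unfold Rdiv. rewrite Rmult_assoc, Rinv_l, Rmult_1_r by lra.
      apply Rsqr_incr_0; [|lra|nra]. unfold Rsqr. nra.
    - intros E. rewrite E in HND.
      apply Rmult_eq_reg_r with (Cmod (D z)); [|lra].
      unfold Rdiv. rewrite Rmult_assoc, Rinv_l, Rmult_1_r by lra.
      apply Rsqr_inj; [lra|nra|]. unfold Rsqr. nra. }
  assert (ET : T 0 = z0).
  { unfold T, N, D. field. unfold r2. intros E. apply RtoC_inj in E. lra. }
  rewrite <- ET.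
  apply (holomorphic_center_le (fun z => F (T z)) rho M Hr).
  - intros z Hz. destruct (HF (T z)) as [l Hl]; [now apply HT|].
    eexists. apply (cderiv_comp F T z l); [|exact Hl]. unfold T.
    apply cderiv_div; [| |auto].
    + unfold N. apply cderiv_scal. apply cderiv_plus; [apply cderiv_id|apply cderiv_const].
    + unfold D. apply cderiv_plus; [apply cderiv_const|]. apply cderiv_scal, cderiv_id.
  - intros z Hz. apply HM. apply HT; lra.
Qed.

(* The quotient w(z)/z is not known to be differentiable at 0, but w (w/z)^n is: its
   difference quotient at 0 is (w/z)^(n+1).  Bound it by the maximum principle and let n
   tend to infinity. *)
Lemma schwarz_lemma (w : C -> C) (z : C) : schwarz w -> Cmod z < 1 -> Cmod (w z) <= Cmod z.
Proof.
  intros [Ha [H0 Hb]] Hz. change (w (RtoC 0) = RtoC 0) in H0.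
  destruct (Ceq_dec z 0) as [->|Hz0]; [rewrite H0; lra|].
  apply Rnot_lt_le. intros Hlt.
  set (a := Cmod z) in *. set (b := Cmod (w z)) in *.
  assert (Ha0 : 0 < a) by now apply Cmod_gt_0.
  assert (Hb1 : b < 1) by now apply Hb.
  (* What matters is a / b < rho < 1: then z lies inside |x| = rho, as a < a / b, and rho b / a
     exceeds 1, so its powers are unbounded. *)
  set (rho := (1 + a / b) / 2).
  assert (Hab : a / b < 1) by (apply Rmult_lt_reg_r with b; [lra|]; unfold Rdiv;
    rewrite Rmult_assoc, Rinv_l by lra; lra).
  assert (Hab2 : a < a / b) by (apply Rmult_lt_reg_r with b; [lra|]; unfold Rdiv;
    rewrite Rmult_assoc, Rinv_l by lra; nra).
  assert (Hrho : a / b < rho < 1) by (unfold rho; lra).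
  assert (Hr0 : 0 < rho) by lra.
  assert (Key : forall n, b * (rho * b / a) ^ n <= 1).
  { intros n.
    assert (HM : Cmod (w z * (w z / z) ^ n) <= (/ rho) ^ n).
    { apply (maximum_modulus (fun x => w x * (w x / x) ^ n)%C rho); [lra| | |fold a; lra].
      - intros x Hx. destruct (Ha x) as [l Hl]; [change (Cmod x < 1); lra|].
        destruct (Ceq_dec x 0) as [->|Hx0].
        + destruct (cderiv_slope _ _ _ Hl) as [q [Hq [_ Eq]]].
          exists (q 0 ^ S n)%C.
          apply slope_cderiv with (q := fun x => (q x ^ S n)%C) (d := 1); auto; [lra|
            now apply ccont_pow|].
          intros x _. specialize (Eq x). rewrite H0 in *. rewrite Cminus_0_r in *.
          rewrite Cminus_0_r in Eq.
          (* At 0 the factor w(0) = 0 absorbs the default value of the division by 0. *)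
          destruct (Ceq_dec x 0) as [->|Hx0]; [rewrite H0; ring|].
          rewrite Eq. replace (q x * x / x)%C with (q x) by (field; exact Hx0). simpl. ring.
        + destruct (cderiv_ex_pow (fun x => w x / x)%C n x _
            (cderiv_div _ _ _ _ _ Hl (cderiv_id x) Hx0)) as [m Hm].
          eexists. exact (cderiv_mult _ _ _ _ _ Hl Hm).
      - intros x Hx.
        assert (Hx0 : x <> 0) by (apply Cmod_gt_0; lra).
        rewrite Cmod_mult, Cmod_pow, Cmod_div by exact Hx0. rewrite Hx.
        assert (Hw : Cmod (w x) < 1) by (apply Hb; change (Cmod x < 1); lra).
        pose proof (Cmod_ge_0 (w x)).
        assert (Hi : 0 < / rho) by (apply Rinv_0_lt_compat; lra).
        rewrite <- (Rmult_1_l ((/ rho) ^ n)). apply Rmult_le_compat; [lra| |lra|].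
        + apply pow_le. apply Rmult_le_pos; lra.
        + apply pow_incr. split; [apply Rmult_le_pos; lra|]. unfold Rdiv. nra. }
    rewrite Cmod_mult, Cmod_pow, Cmod_div in HM by exact Hz0. fold a b in HM.
    replace (rho * b / a) with (b / a * rho) by (field; lra).
    rewrite Rpow_mult_distr. rewrite pow_inv in HM.
    assert (Hp : 0 < rho ^ n) by (apply pow_lt; lra).
    apply Rmult_le_compat_r with (r := rho ^ n) in HM; [|lra].
    rewrite Rinv_l in HM by lra. lra. }
  assert (H1 : 1 < rho * b / a).
  { apply Rmult_lt_reg_r with (a / b); [apply Rdiv_lt_0_compat; lra|].
    replace (rho * b / a * (a / b)) with rho by (field; lra). lra. }
  destruct (Pow_x_infinity (rho * b / a)) with (b := 2 / b) as [n Hn].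
  { rewrite Rabs_pos_eq; lra. }
  specialize (Hn n (le_n n)). rewrite Rabs_pos_eq in Hn by (apply pow_le; lra).
  apply Rge_le in Hn. apply Rmult_le_compat_l with (r := b) in Hn; [|lra].
  replace (b * (2 / b)) with 2 in Hn by (field; lra). specialize (Key n). lra.
Qed.

(** * Sequences with geometrically decreasing steps *)

Lemma real_geometric_cv (u : nat -> R) (K q : R) : 0 <= q < 1 ->
  (forall n, Rabs (u (S n) - u n) <= K * q ^ n) -> ex_finite_lim_seq u.
Proof.
  intros Hq H.
  assert (Hs : ex_series (fun n => u (S n) - u n)).
  { apply (ex_series_le (K := R_AbsRing) (V := R_CompleteNormedModule)) with (b := fun n => K * q ^ n).
    - exact H.
    - apply (ex_series_scal_l K (fun n => q ^ n)). apply ex_series_geom.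
      rewrite Rabs_pos_eq; lra. }
  destruct Hs as [l Hl]. exists (l + u 0%nat).
  apply is_lim_seq_incr_1.
  apply is_lim_seq_ext with (fun n => sum_n (fun k => u (S k) - u k) n + u 0%nat).
  - intros n. induction n as [|n IH].
    + rewrite sum_O. lra.
    + rewrite sum_Sn. unfold plus; simpl. lra.
  - apply is_lim_seq_plus'; [exact Hl|apply is_lim_seq_const].
Qed.

(** Two consecutive terms close to Z at one index: the form in which z_(n+1) = T(z_n) passes to the
    limit. *)
Lemma complex_geometric_cv (z : nat -> C) (K q : R) : 0 <= q < 1 ->
  (forall n, Cmod (z (S n) - z n) <= K * q ^ n) ->
  exists Z : C, forall eps, 0 < eps -> exists n, Cmod (z n - Z) < eps /\ Cmod (z (S n) - Z) < eps.
Proof.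
  intros Hq H.
  destruct (real_geometric_cv (fun n => fst (z n)) K q Hq) as [x Hx].
  { intros n. eapply Rle_trans; [|apply H].
    eapply Rle_trans; [|apply re_le_Cmod]. right. reflexivity. }
  destruct (real_geometric_cv (fun n => snd (z n)) K q Hq) as [y Hy].
  { intros n. eapply Rle_trans; [|apply H].
    eapply Rle_trans; [|apply Rmax_Cmod]. apply Rmax_r. }
  exists (x, y). intros eps He. assert (He2 : 0 < eps / 2) by lra.
  apply is_lim_seq_spec in Hx. apply is_lim_seq_spec in Hy.
  destruct (Hx (mkposreal _ He2)) as [N1 K1]. destruct (Hy (mkposreal _ He2)) as [N2 K2].
  assert (B : forall n, (N1 + N2 <= n)%nat -> Cmod (z n - (x, y)) < eps).
  { intros n Hn. specialize (K1 n ltac:(lia)). specialize (K2 n ltac:(lia)).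
    simpl in K1, K2.
    eapply Rle_lt_trans; [apply Cmod_2Rmax|].
    assert (Hm : Rmax (Rabs (fst (z n - (x, y))%C)) (Rabs (snd (z n - (x, y))%C)) < eps / 2)
      by (apply Rmax_lub_lt; [exact K1|exact K2]).
    assert (0 <= Rmax (Rabs (fst (z n - (x, y))%C)) (Rabs (snd (z n - (x, y))%C)))
      by (eapply Rle_trans; [apply Rabs_pos|apply Rmax_l]).
    pose proof sqrt2_le_2.
    pose proof (sqrt_pos 2). nra. }
  exists (N1 + N2)%nat. split; apply B; lia.
Qed.

(** * The inverse of the nephroid map *)

(** This is [phiNe] - 1; the shift turns |q - 1| < 2/3 into a disc about 0. *)
Definition nephroid_cubic (z : C) : C := (z - z * (z * z) / 3)%C.

Lemma Cmod_minus_sym (a b : C) : Cmod (a - b) = Cmod (b - a).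
Proof. rewrite <- Cmod_opp. f_equal. ring. Qed.

Lemma RtoC3_neq_0 : RtoC 3 <> RtoC 0.
Proof. intros E. apply RtoC_inj in E. lra. Qed.

(** In x^3 - y^3 = (x^2 + x y + y^2)(x - y) the first factor is at most 3 rho^2 in modulus; the
    division by 3 leaves a contraction when rho < 1. *)
Lemma cube_diff_bound (x y : C) (rho : R) : Cmod x <= rho -> Cmod y <= rho ->
  Cmod (x * (x * x) / 3 - y * (y * y) / 3) <= rho ^ 2 * Cmod (x - y).
Proof.
  intros Hx Hy. pose proof RtoC3_neq_0 as H3.
  replace (x * (x * x) / 3 - y * (y * y) / 3)%C
    with ((x * x + (x * y + y * y)) / 3 * (x - y))%C by (field; exact H3).
  rewrite Cmod_mult, Cmod_div by exact H3. rewrite Cmod_R, (Rabs_pos_eq 3) by lra.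
  apply Rmult_le_compat_r; [apply Cmod_ge_0|].
  pose proof (Cmod_ge_0 x). pose proof (Cmod_ge_0 y).
  assert (Cmod (x * x + (x * y + y * y)) <= 3 * rho ^ 2); [|lra].
  eapply Rle_trans; [apply Cmod_triangle|].
  eapply Rle_trans; [apply Rplus_le_compat_l, Cmod_triangle|]. rewrite !Cmod_mult.
  assert (forall a b, 0 <= a <= rho -> 0 <= b <= rho -> a * b <= rho * rho)
    by (intros; apply Rmult_le_compat; lra).
  pose proof (H1 _ _ (conj H Hx) (conj H Hx)). pose proof (H1 _ _ (conj H Hx) (conj H0 Hy)).
  pose proof (H1 _ _ (conj H0 Hy) (conj H0 Hy)). lra.
Qed.

(* Fixed point of the contraction z |-> c + z^3/3 on the disc of radius rho, where
   rho = 1 - sqrt (2/3 - |c|) satisfies |c| + rho^3/3 <= rho. *)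
Lemma nephroid_cubic_surj (c : C) : Cmod c < 2 / 3 ->
  exists z, Cmod z < 1 /\ nephroid_cubic z = c.
Proof.
  intros Hc. pose proof RtoC3_neq_0 as H3. pose proof (Cmod_ge_0 c) as Hc0.
  set (t := sqrt (2 / 3 - Cmod c)).
  assert (Ht : 0 < t) by (apply sqrt_lt_R0; lra).
  assert (Ht2 : t * t = 2 / 3 - Cmod c) by (apply sqrt_sqrt; lra).
  assert (Ht1 : t < 1) by nra.
  set (rho := 1 - t).
  (* Indeed rho - rho^3/3 = 2/3 - t^2 + t^3/3 = |c| + t^3/3. The square root in t reflects that x -
     x^3/3 has a critical point at 1, with value 2/3. *)
  assert (Hrho : Cmod c + rho ^ 3 / 3 <= rho) by (unfold rho; nra).
  set (T := fun z : C => (c + z * (z * z) / 3)%C).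
  set (zz := fun n => Nat.iter n T 0%C).
  assert (HT : forall z, Cmod z <= rho -> Cmod (T z) <= rho).
  { intros z Hz. unfold T. eapply Rle_trans; [apply Cmod_triangle|].
    rewrite Cmod_div by exact H3. rewrite !Cmod_mult, Cmod_R, (Rabs_pos_eq 3) by lra.
    pose proof (pow_incr (Cmod z) rho 3 (conj (Cmod_ge_0 z) Hz)). simpl in *. lra. }
  assert (Hb : forall n, Cmod (zz n) <= rho).
  { intros n. induction n as [|n IH].
    - change (zz 0%nat) with (RtoC 0). rewrite Cmod_0. unfold rho. lra.
    - apply (HT _ IH). }
  assert (Hr : 0 <= rho ^ 2 < 1) by (unfold rho; nra).
  destruct (complex_geometric_cv zz (Cmod (zz 1%nat - zz 0%nat)) (rho ^ 2) Hr) as [Z HZ].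
  { intros n. induction n as [|n IH]; [simpl; lra|].
    replace (zz (S (S n)) - zz (S n))%C
      with (zz (S n) * (zz (S n) * zz (S n)) / 3 - zz n * (zz n * zz n) / 3)%C.
    - eapply Rle_trans; [apply (cube_diff_bound _ _ rho); apply Hb|].
      rewrite <- (tech_pow_Rmult (rho ^ 2) n).
      apply Rmult_le_compat_l with (r := rho ^ 2) in IH; [lra|lra].
    - change (zz (S (S n))) with (T (zz (S n))). unfold T.
      replace (zz (S n)) with (T (zz n)) at 7 by reflexivity. unfold T. ring. }
  assert (HZr : Cmod Z <= rho).
  { apply Rle_plus_epsilon. intros e He. destruct (HZ e He) as [n [Hn _]].
    replace Z with (zz n + (Z - zz n))%C by ring.
    eapply Rle_trans; [apply Cmod_triangle|]. rewrite Cmod_minus_sym. specialize (Hb n). lra. }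
  exists Z. split; [unfold rho in *; lra|].
  assert (E : (Z - T Z)%C = 0).
  { apply Cmod_eq_0. apply Rle_antisym; [|apply Cmod_ge_0].
    apply Rle_plus_epsilon. intros e He. destruct (HZ (e / 2) ltac:(lra)) as [n [Hn Hn']].
    (* Here Z - T Z = (Z - z_(n+1)) + (T z_n - T Z), and T does not increase distances on the
       disc. *)
    replace (Z - T Z)%C with ((Z - zz (S n)) + (zz n * (zz n * zz n) / 3 - Z * (Z * Z) / 3))%C.
    - eapply Rle_trans; [apply Cmod_triangle|]. rewrite Cmod_minus_sym.
      pose proof (cube_diff_bound _ _ rho (Hb n) HZr). pose proof (Cmod_ge_0 (zz n - Z)). nra.
    - change (zz (S n)) with (T (zz n)). unfold T. ring. }
  unfold nephroid_cubic. replace c with (T Z - Z * (Z * Z) / 3)%C by (unfold T; ring).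
  replace (T Z) with (Z - (Z - T Z))%C by ring. rewrite E. ring.
Qed.

Lemma nephroid_cubic_diff (x y : C) : (nephroid_cubic x - nephroid_cubic y =
  (1 - (x * x + (x * y + y * y)) / 3) * (x - y))%C.
Proof. unfold nephroid_cubic. field. Qed.

(** The bound involves y alone, so x may lie on the unit circle while |y| < 1 keeps the slope away
    from 0. *)
Lemma nephroid_slope_lower (x y : C) : Cmod x <= 1 ->
  1 - (1 + Cmod y + Cmod y ^ 2) / 3 <= Cmod (1 - (x * x + (x * y + y * y)) / 3).
Proof.
  intros Hx. pose proof (Cmod_ge_0 x). pose proof (Cmod_ge_0 y).
  set (s := (x * x + (x * y + y * y))%C).
  assert (Hs : Cmod s <= 1 + Cmod y + Cmod y ^ 2).
  { unfold s. eapply Rle_trans; [apply Cmod_triangle|].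
    eapply Rle_trans; [apply Rplus_le_compat_l, Cmod_triangle|]. rewrite !Cmod_mult. nra. }
  assert (Ht : Cmod 1 <= Cmod (1 - s / 3) + Cmod (s / 3)).
  { replace (RtoC 1) with ((1 - s / 3) + s / 3)%C at 1 by ring. apply Cmod_triangle. }
  rewrite Cmod_1, Cmod_div, Cmod_R, (Rabs_pos_eq 3) in Ht by first [apply RtoC3_neq_0 | lra]. lra.
Qed.

Lemma nephroid_slope_pos (y : C) : Cmod y < 1 -> 0 < 1 - (1 + Cmod y + Cmod y ^ 2) / 3.
Proof. intros Hy. pose proof (Cmod_ge_0 y). nra. Qed.

(** The case |x| = 1 serves for x = 1 and x = -1: the cusp values are not taken in the open disc. *)
Lemma nephroid_cubic_inj (x y : C) : Cmod x <= 1 -> Cmod y < 1 ->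
  nephroid_cubic x = nephroid_cubic y -> x = y.
Proof.
  intros Hx Hy E. pose proof (nephroid_cubic_diff x y) as F.
  rewrite E in F. replace (nephroid_cubic y - nephroid_cubic y)%C with (RtoC 0) in F by ring.
  pose proof (nephroid_slope_lower x y Hx). pose proof (nephroid_slope_pos y Hy).
  destruct (Ceq_dec x y) as [e|N]; [exact e|exfalso].
  apply (Cmult_neq_0 (1 - (x * x + (x * y + y * y)) / 3)%C (x - y)%C).
  - apply Cmod_gt_0. lra.
  - now apply Cminus_eq_contra.
  - now rewrite <- F.
Qed.

(** The preimage is picked by choice. The slopes of the cubic from z = psi(c) to points of the disc
    are at least k > 0 in modulus, so |psi(x) - z| <= |x - c| / k; continuity follows, and then
    differentiability with the reciprocal slope. *)
Lemma nephroid_inverse : exists psi : C -> C, forall c, Cmod c < 2 / 3 ->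
  Cmod (psi c) < 1 /\ nephroid_cubic (psi c) = c /\ exists l, has_cderiv psi c l.
Proof.
  set (psi := fun c => epsilon (inhabits (RtoC 0)) (fun z => Cmod z < 1 /\ nephroid_cubic z = c)).
  assert (Hpsi : forall c, Cmod c < 2 / 3 -> Cmod (psi c) < 1 /\ nephroid_cubic (psi c) = c).
  { intros c Hc. apply (epsilon_spec (inhabits (RtoC 0))
      (fun z => Cmod z < 1 /\ nephroid_cubic z = c)). now apply nephroid_cubic_surj. }
  exists psi. intros c Hc. destruct (Hpsi c Hc) as [H1 H2]. split; [exact H1|]. split; [exact H2|].
  set (z := psi c) in *. set (k := 1 - (1 + Cmod z + Cmod z ^ 2) / 3).
  assert (Hk : 0 < k) by now apply nephroid_slope_pos.
  set (s := fun x => (1 - (x * x + (x * z + z * z)) / 3)%C).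
  assert (Hs : forall x, Cmod x < 1 -> k <= Cmod (s x))
    by (intros x Hx; apply nephroid_slope_lower; lra).
  assert (Hnear : forall x, Cmod (x - c) < 2 / 3 - Cmod c -> Cmod x < 2 / 3).
  { intros x Hx. replace x with (c + (x - c))%C by ring.
    eapply Rle_lt_trans; [apply Cmod_triangle|]. lra. }
  assert (Hdiff : forall x, Cmod x < 2 / 3 -> (x - c = s (psi x) * (psi x - z))%C).
  { intros x Hx. destruct (Hpsi x Hx) as [G1 G2]. unfold s. rewrite <- nephroid_cubic_diff.
    now rewrite G2, H2. }
  assert (Hcont : ccont psi c).
  { intros e He. exists (Rmin (2 / 3 - Cmod c) (k * e)).
    split; [apply Rmin_pos; [lra|nra]|]. intros x Hx.
    assert (Hx1 : Cmod x < 2 / 3) by (apply Hnear; eapply Rlt_le_trans; [exact Hx|apply Rmin_l]).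
    assert (Hx2 : Cmod (x - c) < k * e) by (eapply Rlt_le_trans; [exact Hx|apply Rmin_r]).
    rewrite (Hdiff x Hx1), Cmod_mult in Hx2. fold z.
    pose proof (Hs (psi x) (proj1 (Hpsi x Hx1))). pose proof (Cmod_ge_0 (psi x - z)).
    apply Rmult_lt_reg_l with k; [exact Hk|]. nra. }
  assert (Hsc : forall x, ccont s x).
  { intros x. unfold s, Cminus, Cdiv.
    apply ccont_plus; [apply ccont_const|].
    (* The subtracted term: |(-u) - (-v)| = |v - u| reduces its continuity to that of u. *)
    intros e He.
    assert (Hcc : ccont (fun x => (x * x + (x * z + z * z)) * / 3)%C x).
    { apply ccont_mult; [|apply ccont_const].
      apply ccont_plus; [apply ccont_mult; apply ccont_id|].
      apply ccont_plus; [|apply ccont_const].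
      apply ccont_mult; [apply ccont_id|apply ccont_const]. }
    destruct (Hcc e He) as [d [Hd K]]. exists d. split; [exact Hd|]. intros y Hy.
    specialize (K y Hy). rewrite Cmod_minus_sym in K.
    eapply Rle_lt_trans; [|exact K]. right. f_equal. ring. }
  (* Here s z = 1 - z^2, the derivative of the cubic at z. *)
  exists (/ s z)%C.
  apply slope_cderiv with (q := fun x => (/ s (psi x))%C) (d := 2 / 3 - Cmod c); [lra| |reflexivity|].
  - apply ccont_inv.
    + apply (ccont_comp s psi); auto.
    + apply Cmod_gt_0. pose proof (Hs z H1). fold z. lra.
  - intros x Hx. pose proof (Hnear x Hx) as Hx'. rewrite (Hdiff x Hx'). fold z. field.
    apply Cmod_gt_0. pose proof (Hs (psi x) (proj1 (Hpsi x Hx'))). lra.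
Qed.

(** * Complex exponential and logarithm *)

Definition cexp (z : C) : C := (exp (fst z) * cos (snd z), exp (fst z) * sin (snd z)).

Lemma cexp_0 : cexp 0 = RtoC 1.
Proof. unfold cexp, RtoC. simpl. rewrite exp_0, cos_0, sin_0. f_equal; ring. Qed.

Lemma cexp_neq_0 (z : C) : cexp z <> 0.
Proof. apply Cmod_gt_0. unfold cexp. rewrite Cmod_exp_polar. apply exp_pos. Qed.

Lemma cderiv_cexp (z : C) : has_cderiv cexp z (cexp z).
Proof.
  destruct z as [x y]. apply differentiable_cderiv; simpl.
  - apply differentiable_pt_lim_exp_cos.
  - apply differentiable_pt_lim_exp_sin.
Qed.

(** The principal logarithm on the right half-plane, where the argument is atan (y / x). *)
Definition clog (z : C) : C := (/ 2 * ln (fst z * fst z + snd z * snd z), atan (snd z * / fst z)).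

Lemma cderiv_clog (z : C) : 0 < fst z -> has_cderiv clog z (/ z)%C.
Proof.
  destruct z as [x y]. simpl. intros Hx.
  assert (Hm : 0 < x * x + y * y) by nra.
  apply differentiable_cderiv; simpl.
  - eapply differentiable_pt_lim_eq.
    + eapply (differentiable_pt_lim_comp1 (fun t => / 2 * ln t)
               (fun u v => u * u + v * v) x y _ _ (/ 2 * / (x * x + y * y))).
      * apply is_derive_Reals. auto_derive; [exact Hm|ring].
      * apply differentiable_pt_lim_add; apply differentiable_pt_lim_mul;
          first [apply differentiable_pt_lim_fst|apply differentiable_pt_lim_snd].
    + cbv beta. field. nra.
    + cbv beta. field. nra.
  - assert (E : 1 + Rsqr (y * / x) <> 0) by (pose proof (Rle_0_sqr (y * / x)); lra).
    eapply differentiable_pt_lim_eq.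
    + eapply (differentiable_pt_lim_comp1 atan (fun u v => v * / u)).
      * apply derivable_pt_lim_atan.
      * apply differentiable_pt_lim_mul; [apply differentiable_pt_lim_snd|].
        eapply (differentiable_pt_lim_comp1 Rinv (fun u _ => u) x y _ _ (- / (x * x))).
        -- apply is_derive_Reals. auto_derive; [lra|field; lra].
        -- apply differentiable_pt_lim_fst.
    + cbv beta. unfold Rsqr in *. field. split; nra.
    + cbv beta. unfold Rsqr in *. field. split; nra.
Qed.

(** * Janowski functions *)

Lemma phiNe_nephroid (z : C) : phiNe z = (1 + nephroid_cubic z)%C.
Proof.
  change (((1 + z) - (z * (z * z)) / 3)%C = (1 + nephroid_cubic z)%C).
  unfold nephroid_cubic. ring.
Qed.

(** A positive real part gives more than a nonzero denominator: 1 + B z stays in the half-plane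
    where [clog] is differentiable. *)
Lemma janowski_den_Re (B : R) (z : C) : Rabs B <= 1 -> Cmod z < 1 -> 0 < fst (1 + B * z)%C.
Proof.
  intros HB Hz.
  assert (H : Rabs (Re (B * z)) < 1).
  { eapply Rle_lt_trans; [apply re_le_Cmod|]. rewrite Cmod_mult, Cmod_R.
    pose proof (Cmod_ge_0 z). nra. }
  apply Rabs_lt_between in H. unfold Re in H. simpl in *. lra.
Qed.

Lemma janowski_den_neq_0 (B : R) (z : C) : Rabs B <= 1 -> Cmod z < 1 -> (1 + B * z)%C <> 0.
Proof.
  intros HB Hz E. pose proof (janowski_den_Re B z HB Hz) as H. rewrite E in H. simpl in H. lra.
Qed.

Lemma janowski_den_lower (B : R) (z : C) : 1 - Rabs B * Cmod z <= Cmod (1 + B * z).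
Proof.
  assert (H : Cmod 1 <= Cmod (1 + B * z) + Cmod (- (B * z))).
  { replace (RtoC 1) with ((1 + B * z) + - (B * z))%C at 1 by ring. apply Cmod_triangle. }
  rewrite Cmod_1, Cmod_opp, Cmod_mult, Cmod_R in H. lra.
Qed.

Lemma janowski_minus_1 (A B : R) (z : C) : (1 + B * z)%C <> 0 ->
  janowski A B z = (1 + RtoC (A - B) * z / (1 + B * z))%C.
Proof.
  intros H.
  change (((1 + A * z) / (1 + B * z))%C = (1 + RtoC (A - B) * z / (1 + B * z))%C).
  rewrite RtoC_minus. field. exact H.
Qed.

(** The last hypothesis rearranges to 3 (A - B)|z| < 2 (1 - |B||z|), and |1 + B z| >= 1 - |B||z|. *)
Lemma janowski_minus_1_bound (A B : R) (z : C) : B < A -> Rabs B <= 1 -> Cmod z < 1 ->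
  (3 * (A - B) + 2 * Rabs B) * Cmod z < 2 ->
  Cmod (RtoC (A - B) * z / (1 + B * z)) < 2 / 3.
Proof.
  intros HBA HB Hz H.
  pose proof (janowski_den_lower B z) as Hl.
  pose proof (janowski_den_neq_0 B z HB Hz) as Hn.
  assert (Hp : 0 < Cmod (1 + B * z)) by now apply Cmod_gt_0.
  rewrite Cmod_div by exact Hn. rewrite Cmod_mult, Cmod_R, Rabs_pos_eq by lra.
  apply Rmult_lt_reg_r with (Cmod (1 + B * z)); [exact Hp|].
  unfold Rdiv at 1. rewrite Rmult_assoc, Rinv_l by lra. lra.
Qed.

(** * Dilations and the inclusion up to the radius *)

Lemma cderiv_dilate (f : C -> C) (r : R) (z l : C) : r <> 0 -> has_cderiv f (r * z)%C l ->
  has_cderiv (fun x => f (r * x) / r)%C z l.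
Proof.
  intros Hr H. assert (Hr' : RtoC r <> 0) by (intros E; apply Hr; now apply RtoC_inj in E).
  eapply cderiv_eq.
  - apply cderiv_div; [|apply cderiv_const|exact Hr'].
    apply (cderiv_comp f (fun x => r * x)%C); [apply cderiv_scal, cderiv_id|exact H].
  - cbv beta. field. exact Hr'.
Qed.

(** The new Schwarz function is psi(c(z)) with c(z) = J(w(r z)) - 1, where psi inverts the cubic. *)
Lemma SstarJ_dilate_SstarNe (A B r : R) (f : C -> C) : B < A -> Rabs B <= 1 ->
  0 < r <= 1 -> (3 * (A - B) + 2 * Rabs B) * r <= 2 -> SstarJ A B f ->
  SstarNe (fun z => f (r * z) / r)%C.
Proof.
  intros HBA HB Hr HD [[Han [H0 H1]] [w [Hw HQ]]].
  change (f (RtoC 0) = RtoC 0) in H0. change (has_cderiv f (RtoC 0) (RtoC 1)) in H1.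
  assert (Hr0 : r <> 0) by lra.
  assert (Hr' : RtoC r <> 0) by (intros E; apply RtoC_inj in E; lra).
  assert (HK : 0 < 3 * (A - B) + 2 * Rabs B) by (pose proof (Rabs_pos B); lra).
  assert (Hrz : forall z, Cmod z < 1 -> Cmod (r * z) < r).
  { intros z Hz. rewrite Cmod_mult, Cmod_R, Rabs_pos_eq by lra. nra. }
  (* Strict, because |w(r z)| <= |r z| < r. Thus equality in the assumed bound on r still gives
     |c(z)| < 2/3. *)
  assert (Hwr : forall z, Cmod z < 1 -> Cmod (w (r * z)%C) < r).
  { intros z Hz. specialize (Hrz z Hz).
    eapply Rle_lt_trans; [apply schwarz_lemma|]; auto. lra. }
  destruct Hw as [Hwa [Hw0 Hwb]]. change (w (RtoC 0) = RtoC 0) in Hw0.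
  destruct nephroid_inverse as [psi Hpsi].
  set (c := fun z => (RtoC (A - B) * w (r * z) / (1 + B * w (r * z)))%C).
  assert (Hc : forall z, Cmod z < 1 -> Cmod (c z) < 2 / 3).
  { intros z Hz. specialize (Hwr z Hz). apply janowski_minus_1_bound; auto; nra. }
  split; [split; [|split]|].
  - intros z Hz. change (Cmod z < 1) in Hz. specialize (Hrz z Hz).
    destruct (Han (r * z)%C) as [l Hl]; [change (Cmod (r * z) < 1); lra|].
    exists l. now apply cderiv_dilate.
  - change ((f (r * 0) / r)%C = 0). replace (r * 0)%C with (RtoC 0) by ring.
    rewrite H0. field. exact Hr'.
  - apply cderiv_dilate; [exact Hr0|].
    change (has_cderiv f (r * 0)%C (RtoC 1)).
    replace (r * 0)%C with (RtoC 0) by ring. exact H1.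
  - exists (fun z => psi (c z)). split; [split; [|split]|].
    + intros z Hz. change (Cmod z < 1) in Hz.
      destruct (Hpsi _ (Hc z Hz)) as [_ [_ [l Hl]]].
      pose proof (Hrz z Hz). pose proof (Hwr z Hz).
      destruct (Hwa (r * z)%C) as [m Hm]; [change (Cmod (r * z) < 1); lra|].
      assert (Hwc : has_cderiv (fun x => w (r * x)%C) z (m * (r * 1))%C)
        by (apply (cderiv_comp w (fun x => r * x)%C); [apply cderiv_scal, cderiv_id|exact Hm]).
      eexists. apply (cderiv_comp psi c); [|exact Hl]. unfold c.
      apply cderiv_div.
      * apply cderiv_scal. exact Hwc.
      * apply cderiv_plus; [apply cderiv_const|]. apply cderiv_scal. exact Hwc.
      * apply janowski_den_neq_0; auto. lra.
    + assert (Ec : c C0 = RtoC 0).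
      { unfold c. change C0 with (RtoC 0). replace (r * 0)%C with (RtoC 0) by ring.
        rewrite Hw0. field. }
      (* Since [psi] is a chosen preimage, psi(0) = 0 comes from injectivity. *)
      rewrite Ec. destruct (Hpsi (RtoC 0)) as [P1 [P2 _]]; [rewrite Cmod_0; lra|].
      apply nephroid_cubic_inj; [lra| |].
      * change (Cmod 0 < 1). rewrite Cmod_0. lra.
      * rewrite P2. change C0 with (RtoC 0). unfold nephroid_cubic. field.
    + intros z Hz. apply Hpsi. now apply Hc.
    + intros z Hz Hz0. change (Cmod z < 1) in Hz. change (z <> RtoC 0) in Hz0.
      pose proof (Hrz z Hz). pose proof (Hwr z Hz).
      destruct (HQ (r * z)%C) as [F0 [l [Hl El]]];
        [change (Cmod (r * z) < 1); lra|now apply Cmult_neq_0|].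
      change (f (r * z)%C <> RtoC 0) in F0.
      change ((r * z * l / f (r * z))%C = janowski A B (w (r * z)%C)) in El.
      split.
      * change ((f (r * z) / r)%C <> 0). unfold Cdiv. apply Cmult_neq_0; [exact F0|].
        intros E. apply (Cmult_neq_0 r (/ r)%C Hr').
        -- intros E'. rewrite E' in E. apply C1_nz.
           replace (RtoC 1) with (r * / r)%C by (field; exact Hr'). rewrite E'. ring.
        -- rewrite E. ring.
      * exists l. split; [now apply cderiv_dilate|].
        change ((z * l / (f (r * z) / r))%C = phiNe (psi (c z))).
        rewrite phiNe_nephroid. destruct (Hpsi _ (Hc z Hz)) as [_ [-> _]].
        unfold c. rewrite <- janowski_minus_1 by (apply janowski_den_neq_0; auto; lra).
        rewrite <- El. field. auto.
Qed.

(** L is log (f(z) / z) for the extremal f: z f'/f - 1 = (A - B) z / (1 + B z) means L' = (A - B) /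
    (1 + B z). The primitive ((A - B) / B) log (1 + B z) needs B nonzero, hence the two cases. *)
Lemma janowski_log (A B : R) : Rabs B <= 1 -> exists L : C -> C, L 0 = RtoC 0 /\
  forall z, Cmod z < 1 -> has_cderiv L z (RtoC (A - B) / (1 + B * z))%C.
Proof.
  intros HB. destruct (Req_dec B 0) as [->|HB0].
  - exists (fun z => RtoC A * z)%C. split; [ring|]. intros z _.
    eapply cderiv_eq; [apply cderiv_scal, cderiv_id|].
    rewrite Rminus_0_r. field.
  - assert (HB' : RtoC B <> 0) by (intros E; apply RtoC_inj in E; lra).
    exists (fun z => RtoC (A - B) / B * clog (1 + B * z))%C. split.
    + replace (1 + B * 0)%C with (RtoC 1) by ring.
      assert (E : clog 1 = RtoC 0).
      { unfold clog, RtoC. simpl. f_equal.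
        - replace (1 * 1 + 0 * 0) with 1 by ring. rewrite ln_1. ring.
        - rewrite Rmult_0_l. apply atan_0. }
      rewrite E. ring.
    + intros z Hz. pose proof (janowski_den_neq_0 B z HB Hz) as Hn.
      eapply cderiv_eq.
      * apply cderiv_scal. apply (cderiv_comp clog (fun x => 1 + B * x)%C).
        -- apply cderiv_plus; [apply cderiv_const|]. apply cderiv_scal, cderiv_id.
        -- apply cderiv_clog. now apply janowski_den_Re.
      * field. auto.
Qed.

(* The extremal function is z (1 + B z)^((A - B) / B), read as z e^(A z) when B = 0. *)
Lemma janowski_extremal (A B : R) : Rabs B <= 1 -> exists f : C -> C, SstarJ A B f /\
  forall z l, Cmod z < 1 -> z <> 0 -> has_cderiv f z l ->
    f z <> 0 /\ (z * l / f z)%C = janowski A B z.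
Proof.
  intros HB. destruct (janowski_log A B HB) as [L [L0 HL]].
  set (f := fun z => (z * cexp (L z))%C).
  assert (Hf : forall z, Cmod z < 1 -> has_cderiv f z
      (1 * cexp (L z) + z * (cexp (L z) * (RtoC (A - B) / (1 + B * z))))%C).
  { intros z Hz. apply (cderiv_mult (fun x => x) (fun x => cexp (L x))); [apply cderiv_id|].
    apply (cderiv_comp cexp L); [now apply HL|apply cderiv_cexp]. }
  assert (HQ : forall z l, Cmod z < 1 -> z <> 0 -> has_cderiv f z l ->
    f z <> 0 /\ (z * l / f z)%C = janowski A B z).
  { intros z l Hz Hz0 Hl. pose proof (cexp_neq_0 (L z)) as He.
    split; [unfold f; now apply Cmult_neq_0|].
    rewrite (cderiv_unique _ _ _ _ Hl (Hf z Hz)).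
    pose proof (janowski_den_neq_0 B z HB Hz) as Hn.
    rewrite janowski_minus_1 by exact Hn. unfold f. field. auto. }
  exists f. split; [|exact HQ]. split.
  - split; [|split].
    + intros z Hz. eexists. now apply Hf.
    + change ((0 * cexp (L 0))%C = 0). ring.
    + change (has_cderiv f (RtoC 0) (RtoC 1)). eapply cderiv_eq; [apply Hf; rewrite Cmod_0; lra|].
      rewrite L0, cexp_0. ring.
  - exists (fun z => z). split; [split; [|split]|].
    + intros z _. eexists. apply cderiv_id.
    + reflexivity.
    + auto.
    + intros z Hz Hz0. change (Cmod z < 1) in Hz. change (z <> RtoC 0) in Hz0.
      destruct (HQ z _ Hz Hz0 (Hf z Hz)) as [F0 E].
      split; [exact F0|]. eexists. split; [now apply Hf|exact E].
Qed.

(* On the extremal function z f'/f reaches 1 + 2s/3 (s = -1 or 1) at a point of modulus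
   2 / (3 (A - B) + 2 |B|).  This value is phi_Ne(s), a cusp of the nephroid, and phi_Ne does not take
   it inside the disc. *)
Lemma janowski_Ne_radius_le (A B rho : R) : B < A -> Rabs B <= 1 ->
  Ne_radius_ok (SstarJ A B) rho -> rho * (3 * (A - B) + 2 * Rabs B) <= 2.
Proof.
  intros HBA HB [Hr [Hr1 Hok]]. apply Rnot_lt_le. intros Hlt.
  set (K := 3 * (A - B) + 2 * Rabs B) in *.
  assert (HK : 0 < K) by (unfold K; pose proof (Rabs_pos B); lra).
  (* The sign s is opposite to that of B, so that -2 s B = 2 |B|. *)
  assert (Hs : exists s, Rabs s = 1 /\ s * s = 1 /\ K = 3 * (A - B) - 2 * s * B).
  { destruct (Rle_lt_dec 0 B) as [h|h].
    - exists (- 1). unfold K. rewrite (Rabs_left (- 1)), (Rabs_pos_eq B) by lra. repeat split; lra.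
    - exists 1. unfold K. rewrite Rabs_R1, (Rabs_left B) by lra. repeat split; lra. }
  destruct Hs as [s [Hs1 [Hs2 Hs3]]].
  destruct (janowski_extremal A B HB) as [f [Hf HQ]].
  destruct (Hok f Hf rho Hr (Rle_refl _)) as [_ [v [[Hva [_ Hvb]] Hv]]].
  (* Chosen so that rho x = 2 s / K; the assumption rho K > 2 puts x inside the unit disc. *)
  set (x := 2 * s / (K * rho)).
  assert (HKr : 0 < K * rho) by nra.
  assert (Hx : Rabs x < 1).
  { unfold x, Rdiv. rewrite !Rabs_mult, Rabs_inv, Hs1, (Rabs_pos_eq 2), (Rabs_pos_eq (K * rho)) by lra.
    apply Rmult_lt_reg_r with (K * rho); [exact HKr|].
    rewrite Rmult_assoc, Rinv_l by lra. lra. }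
  assert (Hs0 : s <> 0) by (intros E; rewrite E in Hs2; lra).
  assert (Hx0 : x <> 0).
  { unfold x, Rdiv. repeat apply Rmult_integral_contrapositive_currified; try lra.
    apply Rinv_neq_0_compat. lra. }
  assert (HxC : RtoC x <> RtoC 0) by (intros E; apply RtoC_inj in E; auto).
  assert (HrC : RtoC rho <> RtoC 0) by (intros E; apply RtoC_inj in E; lra).
  assert (HxD : Cmod x < 1) by (rewrite Cmod_R; exact Hx).
  destruct (Hv (RtoC x) HxD HxC) as [_ [l [Hl El]]].
  set (t := (rho * x)%C).
  assert (HtD : Cmod t < 1).
  { unfold t. rewrite Cmod_mult, !Cmod_R, (Rabs_pos_eq rho) by lra. pose proof (Rabs_pos x). nra. }
  assert (Ht0 : t <> 0) by now apply Cmult_neq_0.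
  destruct Hf as [[Han _] _]. destruct (Han t HtD) as [m Hm].
  (* The dilation f(rho z) / rho has at x the derivative f'(rho x), so l is the derivative m of f at
     t. *)
  pose proof (cderiv_unique _ _ _ _ Hl (cderiv_dilate f rho x m ltac:(lra) Hm)) as ->.
  destruct (HQ t m HtD Ht0 Hm) as [Ft Et].
  change ((x * m / (f t / rho))%C = phiNe (v (RtoC x))) in El.
  replace (x * m / (f t / rho))%C with (t * m / f t)%C in El by (unfold t; field; auto).
  rewrite Et, phiNe_nephroid in El.
  pose proof (janowski_den_neq_0 B t HB HtD) as Hn.
  rewrite janowski_minus_1 in El by exact Hn.
  (* With t = 2 s / K the denominator is 3 (A - B) / K, so the quotient is 2 s / 3 = s - s^3 / 3. *)
  assert (Er : (RtoC (A - B) * t / (1 + B * t))%C = nephroid_cubic s).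
  { assert (Etr : t = RtoC (2 * s / K)).
    { unfold t, x. rewrite <- RtoC_mult. f_equal. field. lra. }
    assert (Eden : (1 + B * t)%C = RtoC (3 * (A - B) / K)).
    { rewrite Etr, <- RtoC_mult, <- RtoC_plus. f_equal.
      replace (3 * (A - B)) with (K + 2 * s * B) by lra. field. lra. }
    assert (H3AB : RtoC (3 * (A - B) / K) <> 0) by now rewrite <- Eden.
    unfold nephroid_cubic.
    rewrite Eden, Etr, <- !RtoC_mult, <- RtoC_div, <- RtoC_div, <- RtoC_minus by
      first [lra | intros E; apply H3AB; now rewrite E].
    f_equal. rewrite Hs2. field. lra. }
  (* Injectivity up to the boundary forces v(x) = s, of modulus 1, against |v(x)| < 1. *)
  assert (Ev : RtoC s = v (RtoC x)).
  { apply nephroid_cubic_inj.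
    - rewrite Cmod_R. lra.
    - apply Hvb. exact HxD.
    - rewrite <- Er. replace (nephroid_cubic (v (RtoC x)))
        with (1 + nephroid_cubic (v (RtoC x)) - 1)%C by ring.
      rewrite <- El. ring. }
  specialize (Hvb (RtoC x) HxD). rewrite <- Ev in Hvb. change (Cmod s < 1) in Hvb.
  rewrite Cmod_R in Hvb. lra.
Qed.

Lemma janowski_Ne_radius (A B : R) : B < A -> Rabs B <= 1 ->
  is_Ne_radius (SstarJ A B) (Rmin 1 (2 / (3 * (A - B) + 2 * Rabs B))).
Proof.
  intros HBA HB. set (K := 3 * (A - B) + 2 * Rabs B).
  assert (HK : 0 < K) by (unfold K; pose proof (Rabs_pos B); lra).
  assert (HK2 : 2 / K * K = 2) by (field; lra).
  assert (Hq : 0 < 2 / K) by (apply Rdiv_lt_0_compat; lra).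
  split; [split; [|split]|].
  - apply Rmin_pos; lra.
  - apply Rmin_l.
  - intros f Hf r Hr Hle. pose proof (Rmin_l 1 (2 / K)). pose proof (Rmin_r 1 (2 / K)).
    apply (SstarJ_dilate_SstarNe A B r f); auto; [lra|].
    fold K. rewrite <- HK2, Rmult_comm. apply Rmult_le_compat_r; lra.
  - intros rho Hok. pose proof (janowski_Ne_radius_le A B rho HBA HB Hok) as H. fold K in H.
    apply Rmin_glb; [apply Hok|]. apply Rmult_le_reg_r with K; lra.
Qed.

Lemma SstarJ_sub_SstarNe (A B : R) (f : C -> C) : B < A -> Rabs B <= 1 ->
  3 * (A - B) + 2 * Rabs B <= 2 -> SstarJ A B f -> SstarNe f.
Proof.
  intros HBA HB HK Hf.
  (* The inclusion is the dilation result at r = 1. *)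
  replace f with (fun z => f (1 * z) / 1)%C.
  - apply (SstarJ_dilate_SstarNe A B 1); auto; lra.
  - apply functional_extensionality. intros z. rewrite Cmult_1_l. field.
Qed.

Theorem mainTheorem2 :
  (forall A B : R, 0 <= B -> B < A -> A <= 1 ->
     is_Ne_radius (SstarJ A B) (Rmin 1 (2 / (3 * A - B))) /\
     (1 - B <= 3 * (1 - A) -> forall f : Cx -> Cx, SstarJ A B f -> SstarNe f)) /\
  (forall A B : R, -1 <= B -> B < A -> A <= 1 -> B <= 0 ->
     is_Ne_radius (SstarJ A B) (Rmin 1 (2 / (3 * A - 5 * B))) /\
     (3 * (1 + A) <= 5 * (1 + B) -> forall f : Cx -> Cx, SstarJ A B f -> SstarNe f)).
Proof.
  split.
  - intros A B HB0 HBA HA.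
    assert (EB : Rabs B = B) by now apply Rabs_pos_eq.
    assert (HB : Rabs B <= 1) by lra. split.
    + replace (3 * A - B) with (3 * (A - B) + 2 * Rabs B) by lra. now apply janowski_Ne_radius.
    (* The condition 1 - B <= 3 (1 - A) is 3 A - B <= 2; likewise 3 (1 + A) <= 5 (1 + B) below is 3
       A - 5 B <= 2. In both cases the radius is 1. *)
    + intros H f. apply SstarJ_sub_SstarNe; lra.
  - intros A B HB1 HBA HA HB0.
    assert (EB : Rabs B = - B) by now apply Rabs_left1.
    assert (HB : Rabs B <= 1) by lra. split.
    + replace (3 * A - 5 * B) with (3 * (A - B) + 2 * Rabs B) by lra. now apply janowski_Ne_radius.
    + intros H f. apply SstarJ_sub_SstarNe; lra.
Qed.
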